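(* For every fixed integer $k \ge 1$, the propositional formulas $\mathrm{Kneser}^n_k$ ($n \ge 2k$) have extended Frege proofs of size polynomial in $n$.
   Context: Notation: $[n]=\{1,\dots,n\}$, and $\binom{n}{k}$ is identified with the set of $k$-element subsets of $[n]$ (the vertices of the $(n,k)$-Kneser graph, in which two vertices are adjacent iff they are disjoint). Let $n \ge 2k > 1$ and $m = n-2k+1$. For $S \in \binom{n}{k}$ and $i \in [m]$ let $p_{S,i}$ be a propositional variable (intended meaning: vertex $S$ is assigned color $i$). The formula $\mathrm{Kneser}^n_k$ is $$\bigwedge_{S \in \binom{n}{k}} \bigvee_{i\in[m]} p_{S,i} \;\rightarrow\; \bigvee_{\substack{S,T\in\binom{n}{k}\\ S\cap T=\emptyset}} \bigvee_{i\in[m]} (p_{S,i}\wedge p_{T,i}).$$ A Frege system is a sound and (implicationally) complete proof system for propositional logic with finitely many axiom schemes and inference rules (e.g. a textbook system whose only rule is modus ponens; all such systems are polynomially equivalent). An extended Frege system is a Frege system augmented with the extension rule, which allows introducing a new propositional variable as an abbreviation of a formula (i.e. adding $q \leftrightarrow \varphi$, with $q$ a fresh variable not occurring earlier in the proof, in $\varphi$, or in the final formula). The size of a proof is the number of symbols in it. ''Size polynomial in $n$'' means: for each fixed $k$ there is a polynomial $f_k$ such that for every $n\ge 2k$ there is such a proof of $\mathrm{Kneser}^n_k$ of size at most $f_k(n)$. *)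

(* Defs.v *)
From HB Require Import structures.
From mathcomp Require Import all_boot.

Set Implicit Arguments.
Unset Strict Implicit.
Unset Printing Implicit Defensive.

Inductive formula : Type :=
| Var of nat
| Top
| Bot
| Neg of formula
| And of formula & formula
| Or of formula & formula
| Imp of formula & formula.

Lemma formula_eq_dec : comparable formula.
Proof. by move=> a b; rewrite /decidable; decide equality; apply: eq_comparable. Qed.

HB.instance Definition _ := hasDecEq.Build formula (compareP formula_eq_dec).

Fixpoint eval (v : nat -> bool) (a : formula) : bool :=
  match a with
  | Var x => v x
  | Top => true
  | Bot => false
  | Neg a => ~~ eval v a
  | And a b => eval v a && eval v b
  | Or a b => eval v a || eval v b
  | Imp a b => eval v a ==> eval v b
  end.

Fixpoint vars (a : formula) : seq nat :=
  match a with
  | Var x => [:: x]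
  | Top | Bot => [::]
  | Neg a => vars a
  | And a b | Or a b | Imp a b => vars a ++ vars b
  end.

(* Number of occurrences of variables, constants and connectives, i.e. the
   length in Polish notation; writing parentheses and separators between lines
   would change sizes by at most a constant factor. *)
Fixpoint fsize (a : formula) : nat :=
  match a with
  | Var _ | Top | Bot => 1
  | Neg a => (fsize a).+1
  | And a b | Or a b | Imp a b => (fsize a + fsize b).+1
  end.

Fixpoint subst (s : nat -> formula) (a : formula) : formula :=
  match a with
  | Var x => s x
  | Top => Top
  | Bot => Bot
  | Neg a => Neg (subst s a)
  | And a b => And (subst s a) (subst s b)
  | Or a b => Or (subst s a) (subst s b)
  | Imp a b => Imp (subst s a) (subst s b)
  end.

Definition Iff (a b : formula) : formula := And (Imp a b) (Imp b a).

(* The constants only arise for the empty sequence. *)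
Fixpoint conj (s : seq formula) : formula :=
  match s with
  | [::] => Top
  | [:: a] => a
  | a :: s => And a (conj s)
  end.

Fixpoint disj (s : seq formula) : formula :=
  match s with
  | [::] => Bot
  | [:: a] => a
  | a :: s => Or a (disj s)
  end.

Definition entails (G : seq formula) (a : formula) : Prop :=
  forall v, all (eval v) G -> eval v a.

(* A schematic rule (premises, conclusion), whose variables stand for arbitrary
   formulas; an axiom scheme is a rule without premises. *)
Definition rule : Type := (seq formula * formula)%type.

Definition inferred (F : seq rule) (prev : seq formula) (a : formula) : Prop :=
  exists r : rule, exists s : nat -> formula,
    [/\ r \in F, a = subst s r.2 & all (fun b => subst s b \in prev) r.1].

Definition derivation (F : seq rule) (G : seq formula) (a : formula)
    (pf : seq formula) : Prop :=
  (exists l, pf = rcons l a) /\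
  (forall prev b next, pf = prev ++ b :: next ->
     b \in G \/ inferred F prev b).

Definition derivable (F : seq rule) (G : seq formula) (a : formula) : Prop :=
  exists pf, derivation F G a pf.

Definition sound (F : seq rule) : Prop :=
  forall G a, derivable F G a -> entails G a.

Definition implicationally_complete (F : seq rule) : Prop :=
  forall G a, entails G a -> derivable F G a.

Definition frege_system (F : seq rule) : Prop :=
  sound F /\ implicationally_complete F.

Definition extension_axiom (prev : seq formula) (final : formula) (a : formula) : Prop :=
  exists q : nat, exists c : formula,
    [/\ a = Iff (Var q) c, q \notin vars c,
        q \notin flatten [seq vars b | b <- prev] & q \notin vars final].

Definition ext_frege_proof (F : seq rule) (a : formula) (pf : seq formula) : Prop :=
  (exists l, pf = rcons l a) /\
  (forall prev b next, pf = prev ++ b :: next ->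
     inferred F prev b \/ extension_axiom prev a b).

Definition proof_size (pf : seq formula) : nat := \sum_(a <- pf) fsize a.

Section Kneser.
Variables n k : nat.

Definition ncolors : nat := n - 2 * k + 1.

Definition vertices : seq {set 'I_n} := enum [set U : {set 'I_n} | #|U| == k].

Definition neighbors (U : {set 'I_n}) : seq {set 'I_n} :=
  [seq V : {set 'I_n} <- vertices | [disjoint U & V]].

(* p_{U,i}; [pickle] numbers the pairs (U, i) injectively. *)
Definition pvar (U : {set 'I_n}) (i : 'I_ncolors) : formula := Var (pickle (U, i)).

Definition kneser : formula :=
  Imp
    (conj [seq disj [seq pvar U i | i <- enum 'I_ncolors] | U <- vertices])
    (disj [seq disj [seq And (pvar U i) (pvar V i) | i <- enum 'I_ncolors]
          | U <- vertices, V <- neighbors U]).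

End Kneser.

(* Main.v *)
Require Import Defs.
From mathcomp Require Import all_boot ssralg poly zify.

Set Implicit Arguments.
Unset Strict Implicit.
Unset Printing Implicit Defensive.

(* Fix k. A colour class of a proper colouring of the Kneser graph is an
   intersecting family. If k^2 + 1 members of a linear family (any two members
   share at most one point) get the same colour, then k + 1 of them form a
   sunflower with a one-point core, and every set of that colour contains the
   core: the class is a star. The lines of a grid form a linear family of about
   n^2 / k^4 sets, so for large n the pigeonhole principle with k^2 n holes
   yields a star; deleting its colour and its centre gives a proper colouring of
   the Kneser graph on n - 1 points with one colour less. All of this has
   polynomial-size proofs, with extension variables for the new colourings and
   for Cook's proof of the pigeonhole principle. After n - O(1) rounds a graph of
   bounded size is left, where a proof exists by completeness, because the
   Kneser formulas are tautologies (Lovasz). The latter follows, as in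
   Matousek's proof, from a parity argument on maximal chains of signed sets
   (Ky Fan's lemma). *)

(** * Frege derivations with size bounds *)

(** A $k$-set missing the core would have to meet $k+1$ disjoint petals; hence the star. Linearity
    makes few members suffice: if no two of $k^2+1$ members are disjoint, one of them meets the
    other $k^2$, so one of its $k$ points lies in $k$ of them, and any two share only that point.
    Without a star each colour thus takes at most $k^2$ lines. Comparing about $n^2/k^4$ lines with
    $k^2 n$ holes gives the threshold $2k^6$. The obstacle is size. Which star exists depends on the
    assignment, so the new colouring is defined by cases over all candidate stars. Unfolding such
    definitions over all rounds would be exponential; extension variables bring every formula back
    to size one. Likewise the size bound is cubed at each level of natural deduction, so the number
    of levels may depend on $k$ only. Whatever has a length growing with $n$ (Cook's induction, the
    search for the first star, the rounds) is glued by cuts whose sizes add up. *)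

Lemma fsize_gt0 a : 0 < fsize a.
Proof. by case: a. Qed.

Lemma fsize_subst s a K :
  0 < K -> (forall x, x \in vars a -> fsize (s x) <= K) ->
  fsize (subst s a) <= fsize a * K.
Proof.
move=> K0; elim: a => //=; try by move=> *; rewrite mul1n.
- by move=> x H; rewrite mul1n H ?inE.
- by move=> a IH H; have := IH H; rewrite mulSn; lia.
all: move=> a IHa b IHb H.
all: have Ha : fsize (subst s a) <= fsize a * K by apply: IHa => x h; rewrite H // mem_cat h.
all: have Hb : fsize (subst s b) <= fsize b * K by apply: IHb => x h; rewrite H // mem_cat h orbT.
all: by rewrite mulSn mulnDl; lia.
Qed.

Lemma eq_subst s t a : {in vars a, s =1 t} -> subst s a = subst t a.
Proof.
elim: a => //=.
- by move=> x H; rewrite H ?inE.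
- by move=> a IH H; rewrite IH.
all: move=> a IHa b IHb H.
all: by rewrite IHa ?IHb // => x h; rewrite H // mem_cat h ?orbT.
Qed.

Lemma subst_subst s t a : subst t (subst s a) = subst (subst t \o s) a.
Proof. by elim: a => //= [a -> | a -> b -> | a -> b -> | a -> b ->]. Qed.

Lemma fsize_subst_ge s a x : x \in vars a -> fsize (s x) <= fsize (subst s a).
Proof.
elim: a => //=.
- by move=> y; rewrite inE => /eqP->.
- by move=> a IH /IH; lia.
all: by move=> a IHa b IHb; rewrite mem_cat => /orP[/IHa|/IHb]; lia.
Qed.

Lemma eval_conj v s : eval v (conj s) = all (eval v) s.
Proof. by elim: s => //= a [|b s] /= IH; rewrite ?andbT // IH. Qed.

Lemma eval_disj v s : eval v (disj s) = has (eval v) s.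
Proof. by elim: s => //= a [|b s] /= IH; rewrite ?orbF // IH. Qed.

Lemma proof_size_nil : proof_size [::] = 0.
Proof. by rewrite /proof_size big_nil. Qed.

Lemma proof_size_cat p q : proof_size (p ++ q) = proof_size p + proof_size q.
Proof. by rewrite /proof_size big_cat. Qed.

Lemma proof_size_rcons p a : proof_size (rcons p a) = proof_size p + fsize a.
Proof. by rewrite -cats1 proof_size_cat /proof_size big_seq1. Qed.

Lemma proof_size_mem p a : a \in p -> fsize a <= proof_size p.
Proof.
elim: p => //= b p IH; rewrite /proof_size big_cons inE => /orP[/eqP->|/IH].
  exact: leq_addr.
rewrite /proof_size; lia.
Qed.

Lemma size_proof_size p : size p <= proof_size p.
Proof.
elim: p => //= b p IH; rewrite /proof_size big_cons; have := fsize_gt0 b.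
by move: IH; rewrite /proof_size; lia.
Qed.

Definition ctx := formula -> Prop.
Definition addc (h : formula) (G : ctx) : ctx := fun b => b = h \/ G b.
Definition unionc (G G' : ctx) : ctx := fun b => G b \/ G' b.
Definition inc (E : seq formula) : ctx := fun b => b \in E.

Section Frege.
Variable F : seq rule.

(** No last line is prescribed, in contrast to [derivation], so that prefixes and concatenations
    stay in the class; the context is a predicate and need not be listed. *)
Inductive valid (G : ctx) : seq formula -> Prop :=
| valid_nil : valid G [::]
| valid_rcons pf b : valid G pf -> G b \/ inferred F pf b -> valid G (rcons pf b).

Lemma inferred_sub (p q : seq formula) a :
  {subset p <= q} -> inferred F p a -> inferred F q a.
Proof.
move=> pq [r [s [rF -> /allP H]]]; exists r, s; split=> //.
by apply/allP => b /H /pq.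
Qed.

Lemma validE G pf : valid G pf ->
  forall prev b next, pf = prev ++ b :: next -> G b \/ inferred F prev b.
Proof.
elim=> [[]|{}pf c _ IH Hc prev b next] //.
case/lastP: next => [|next d].
  by rewrite cats1 => /eqP; rewrite eqseq_rcons => /andP[/eqP<- /eqP<-].
rewrite -rcons_cons -rcons_cat => /eqP; rewrite eqseq_rcons => /andP[/eqP Hpf _].
exact: IH Hpf.
Qed.

Lemma valid_mem G pf b : valid G pf -> b \in pf -> G b \/ inferred F pf b.
Proof.
move=> Hv bpf; case/splitPr: pf / bpf Hv => p1 p2 Hv.
case: (validE Hv erefl) => [|inf]; [by left | right].
by apply: inferred_sub inf => x; rewrite mem_cat => ->.
Qed.

Lemma valid_weak (G G' : ctx) pf : (forall b, G b -> G' b) -> valid G pf -> valid G' pf.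
Proof.
move=> GG'; elim=> [|p b _ IH [Gb|inf]]; first exact: valid_nil.
  by apply: valid_rcons => //; left; apply: GG'.
by apply: valid_rcons => //; right.
Qed.

(* A line of the second derivation that repeats a line of the first one is
   justified again in the same way. *)
Lemma valid_cat G pf1 pf2 :
  valid G pf1 -> valid (unionc (inc pf1) G) pf2 -> valid G (pf1 ++ pf2).
Proof.
move=> H1; elim=> [|p b _ IH Hb]; first by rewrite cats0.
rewrite -rcons_cat; apply: valid_rcons => //.
have sub1 : {subset pf1 <= pf1 ++ p} by move=> x; rewrite mem_cat => ->.
have sub2 : {subset p <= pf1 ++ p} by move=> x; rewrite mem_cat orbC => ->.
case: Hb => [[b1|]|inf]; [|by left|by right; apply: inferred_sub inf].
by case: (valid_mem H1 b1) => [|inf]; [left | right; apply: inferred_sub inf].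
Qed.

(* [L] is the set of all conclusions of one derivation, so that a dag-like
   argument does not pay twice for shared lines. *)
Definition provN (N : nat) (G : ctx) (L : ctx) : Prop :=
  exists pf, [/\ valid G pf, forall b, L b -> b \in pf & proof_size pf <= N].

Lemma provN_weak N N' (G G' L L' : ctx) :
  N <= N' -> (forall b, G b -> G' b) -> (forall b, L' b -> L b) ->
  provN N G L -> provN N' G' L'.
Proof.
move=> NN GG LL [pf [Hv HL Hs]]; exists pf; split; first exact: valid_weak Hv.
  by move=> b /LL /HL.
exact: leq_trans NN.
Qed.

Lemma provN_cut N1 N2 G L L' :
  provN N1 G L -> provN N2 (unionc L G) L' -> provN (N1 + N2) G (unionc L L').
Proof.
move=> [p1 [v1 H1 s1]] [p2 [v2 H2 s2]]; exists (p1 ++ p2); split.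
- apply: valid_cat => //; apply: valid_weak v2 => b [/H1|]; [by left|by right].
- by move=> b [/H1|/H2]; rewrite mem_cat => -> //; rewrite orbT.
- by rewrite proof_size_cat leq_add.
Qed.

Lemma provN_union N1 N2 G L L' :
  provN N1 G L -> provN N2 G L' -> provN (N1 + N2) G (unionc L L').
Proof.
move=> H1 H2; apply: provN_cut => //; apply: provN_weak H2 => // b; by right.
Qed.

Lemma provN_fam (T : eqType) (xs : seq T) N G (f : T -> ctx) :
  (forall x, x \in xs -> provN N G (f x)) ->
  provN (size xs * N) G (fun b => exists2 x, x \in xs & f x b).
Proof.
elim: xs => [|x xs IH] H.
  by exists [::]; rewrite proof_size_nil; split=> [|b []|] //; exact: valid_nil.
have {}IH := IH (fun y hy => H y (@mem_behead _ (x :: xs) y hy)).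
have Hx := H x (mem_head _ _).
have := provN_union Hx IH; rewrite mulSn; apply: provN_weak => // b [y].
by rewrite inE => /orP[/eqP-> | yxs] fb; [left|right; exists y].
Qed.

Lemma provN_hyp (a : formula) (G : ctx) : G a -> provN (fsize a) G (eq a).
Proof.
move=> Ga; exists [:: a]; split.
- by rewrite -[[:: a]]/(rcons [::] a); apply: valid_rcons; [exact: valid_nil|left].
- by move=> b <-; rewrite inE.
- by rewrite /proof_size big_seq1.
Qed.

(** * Instances of entailments and the deduction theorem, with sizes *)

Hypothesis hF : frege_system F.

Lemma inferred_subst s p a :
  inferred F p a -> inferred F (map (subst s) p) (subst s a).
Proof.
move=> [r [t [rF -> /allP H]]]; exists r, (subst s \o t); split=> //.
  exact: subst_subst.
by apply/allP => b br; rewrite -subst_subst; apply: map_f; apply: H.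
Qed.

Lemma derivable_valid G a : derivable F G a ->
  exists2 pf, valid (inc G) pf & a \in pf.
Proof.
move=> [pf [[l Hl] Hpf]]; exists pf; last by rewrite Hl mem_rcons inE eqxx.
have {l Hl} : forall prev next, pf = prev ++ next -> valid (inc G) prev.
  elim/last_ind => [|prev b IH] next e; first exact: valid_nil.
  rewrite cat_rcons in e; apply: valid_rcons; first exact: IH e.
  exact: Hpf e.
by move=> /(_ pf [::]); apply; rewrite cats0.
Qed.

(** Completeness supplies one fixed derivation. An instance is that derivation under a substitution,
    hence of size linear in the substituted formulas. *)
Lemma schema G0 a0 : entails G0 a0 -> exists C, forall s K, 0 < K ->
  (forall x, x \in flatten (map vars (a0 :: G0)) -> fsize (s x) <= K) ->
  provN (C * K) (inc (map (subst s) G0)) (eq (subst s a0)).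
Proof.
move=> /hF.2 /derivable_valid [pf0 v0 a0pf]; exists (proof_size pf0) => s K K0 Hs.
(* Variables that occur only inside the fixed derivation are sent to [Top], since nothing bounds [s]
   on them. *)
pose s' x := if x \in flatten (map vars (a0 :: G0)) then s x else Top.
have eqs b : b \in a0 :: G0 -> subst s' b = subst s b.
  move=> bG; apply: eq_subst => x xb; rewrite /s'.
  by case: ifP => // /negP[]; apply/flattenP; exists (vars b) => //; apply: map_f.
exists (map (subst s') pf0); split.
- elim: v0 => [|p b _ IH Hb]; first exact: valid_nil.
  rewrite map_rcons; apply: valid_rcons => //.
  case: Hb => [bG|inf]; [left | right; exact: inferred_subst].
  by rewrite eqs ?inE ?bG ?orbT //; apply: map_f.
- by move=> b <-; rewrite -eqs ?mem_head //; apply: map_f.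
- elim: pf0 {v0 a0pf} => [|b p IH]; first by rewrite proof_size_nil.
  rewrite map_cons /proof_size !big_cons mulnDl; apply: leq_add; last exact: IH.
  by apply: fsize_subst => // x _; rewrite /s'; case: ifP => // /Hs.
Qed.

(** A rule relativised to a hypothesis is again a valid schema, with the hypothesis as one more
    variable [z]; completeness then derives its instances at linear cost. *)
Lemma deduction_rule (r : rule) : r \in F -> exists C, forall h s K, 0 < K ->
  fsize h <= K ->
  (forall x, x \in flatten (map vars (r.2 :: r.1)) -> fsize (s x) <= K) ->
  provN (C * K) (inc [seq Imp h (subst s b) | b <- r.1])
    (eq (Imp h (subst s r.2))).
Proof.
move=> rF; pose vs := flatten (map vars (r.2 :: r.1)).
pose z := (\max_(x <- vs) x).+1.
have zvs : z \notin vs.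
  by apply/negP => zin; have := @leq_bigmax_seq _ vs xpredT id z zin isT; rewrite ltnn.
(* The premises followed by the conclusion form a derivation, so soundness of [F] makes each single
   rule an entailment. *)
have ent : entails r.1 r.2.
  apply: hF.1; exists (rcons r.1 r.2); split; first by exists r.1.
  move=> prev b next; case/lastP: next => [|next c].
    rewrite cats1 => /eqP; rewrite eqseq_rcons => /andP[/eqP<- /eqP<-]; right.
    have sid : forall b, subst Var b = b.
      by elim=> //= [c ->|c -> d ->|c -> d ->|c -> d ->].
    by exists r, Var; split; rewrite ?sid //; apply/allP => c; rewrite sid.
  rewrite -rcons_cons -rcons_cat => /eqP; rewrite eqseq_rcons => /andP[/eqP-> _].
  by left; rewrite mem_cat mem_head orbT.
have {}ent : entails [seq Imp (Var z) b | b <- r.1] (Imp (Var z) r.2).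
  move=> v /allP H; apply/implyP => /= vz; apply: ent; apply/allP => b br.
  by have := H _ (map_f _ br); rewrite /= vz.
have [C HC] := schema ent; exists C => h s K K0 hK Hs.
pose s' x := if x == z then h else s x.
have eqs b : b \in r.2 :: r.1 -> subst s' (Imp (Var z) b) = Imp h (subst s b).
  move=> br; rewrite /= {1}/s' eqxx; congr Imp.
  apply: eq_subst => x xb; rewrite /s'; case: eqP => // xz.
  case/negP: zvs; rewrite -xz; apply/flattenP; exists (vars b) => //.
  exact: map_f.
rewrite -eqs ?mem_head //.
apply: provN_weak (HC s' K K0 _) => //.
- move=> b; rewrite /inc -map_comp => /mapP[c cr ->] /=.
  by apply/mapP; exists c => //; rewrite -eqs // inE cr orbT.
- move=> x Hx; rewrite /s'; case: eqP => // /eqP xz; apply: Hs.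
  move: Hx => /flattenP[_ /mapP[_ /predU1P[->|/mapP[b br ->]] ->]];
    rewrite inE (negbTE xz) /= => xb; rewrite mem_cat.
    by rewrite [x \in vars r.2]xb.
  by apply/orP; right; apply/flattenP; exists (vars b) => //; apply: map_f.
Qed.

Lemma deduction_rules : exists C, forall r, r \in F -> forall h s K, 0 < K ->
  fsize h <= K ->
  (forall x, x \in flatten (map vars (r.2 :: r.1)) -> fsize (s x) <= K) ->
  provN (C * K) (inc [seq Imp h (subst s b) | b <- r.1])
    (eq (Imp h (subst s r.2))).
Proof.
have : {subset F <= F} by [].
elim: {1 3}F => [|r F' IH] FF; first by exists 0.
have [C1 H1] := deduction_rule (FF _ (mem_head _ _)).
have [C2 H2] := IH (fun x hx => FF x (@mem_behead _ (r :: F') x hx)).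
exists (maxn C1 C2) => r'; rewrite inE => /orP[/eqP->|r'F] h s K K0 hK Hs.
  by apply: provN_weak (H1 h s K K0 hK Hs) => //; rewrite leq_mul2r leq_maxl orbT.
by apply: provN_weak (H2 _ r'F h s K K0 hK Hs) => //; rewrite leq_mul2r leq_maxr orbT.
Qed.

(** The usual translation line by line: at most [N] lines of size at most [N], each replaced by a
    piece of size linear in [N]. The growth is quadratic, so discharges may be nested only to a
    bounded depth. *)
Lemma deductionN : exists C, forall N h G L, 0 < N -> fsize h <= N ->
  provN N (addc h G) L ->
  provN (N * (C * N)) G (fun b => exists2 a, L a & b = Imp h a).
Proof.
have [C1 H1] := deduction_rules.
have [C2 H2] := @schema [::] (Imp (Var 0) (Var 0))
  (fun v _ => implybb (eval v (Var 0))).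
have ent3 : entails [:: Var 0] (Imp (Var 1) (Var 0)).
  by move=> v /=; rewrite andbT => ->; rewrite implybT.
have [C3 H3] := schema ent3.
pose C := C1 + C2 + C3 + 1; exists C => N h G L N0 hN [pf [v HL sz]].
suff: provN (size pf * (C * N)) G (fun b => exists2 a, a \in pf & b = Imp h a).
  apply: provN_weak => // [|b [a /HL apf ->]]; last by exists a.
  by rewrite leq_mul2r (leq_trans (size_proof_size pf)) // orbT.
have {L HL sz} : {in pf, forall a, fsize a <= N}.
  by move=> a /proof_size_mem /leq_trans; apply.
elim: v => {pf}[|pf b vpf IH Hb] Hsz.
  by exists [::]; rewrite proof_size_nil; split=> [|a []|] //; exact: valid_nil.
have Hpf : {in pf, forall a, fsize a <= N}.
  by move=> a apf; apply: Hsz; rewrite mem_rcons inE apf orbT.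
have Hb' : fsize b <= N by apply: Hsz; rewrite mem_rcons mem_head.
have {}IH := IH Hpf.
set L := (fun b => _) in IH.
suff H : provN (C * N) (unionc L G) (eq (Imp h b)).
  have := provN_cut IH H; apply: provN_weak => //.
    by rewrite size_rcons mulSn addnC.
  move=> c [a]; rewrite mem_rcons inE => /orP[/eqP->|apf] ->; first by right.
  by left; exists a.
case: Hb => [[->|Gb]|[r [s [rF e Hr]]]].
- pose s (x : nat) := h; have := H2 s N N0 (fun _ _ => hN) => /=.
  by apply: provN_weak => //; rewrite leq_mul2r /C; lia.
- have := provN_cut (provN_hyp Gb)
    (provN_weak (leqnn _) _ (fun _ x => x) (H3 (fun x => if x == 0 then b else h) N N0 _)).
  move=> H; apply: (@provN_weak _ _ G _ _ _ _ _ _ (H _ _)).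
  + have: N <= C3 * N + N by lia.
    by rewrite /C !mulnDl; lia.
  + by move=> c; right.
  + by move=> c <-; right.
  + by move=> c; rewrite /inc inE => /eqP->; left.
  + by move=> x _; case: ifP.
- rewrite e; have := H1 r rF h s N N0 hN; move=> H; apply: provN_weak (H _).
  + by rewrite leq_mul2r /C; lia.
  + move=> c; rewrite /inc => /mapP[d dr ->]; left; exists (subst s d) => //.
    exact: (allP Hr).
  + by [].
  + move=> x /= ; rewrite mem_cat => /orP[xr|/flattenP[_ /mapP[c cr ->] xc]].
      by apply: leq_trans Hb'; rewrite e; apply: fsize_subst_ge.
    apply: leq_trans (Hpf _ (allP Hr _ cr)); exact: fsize_subst_ge.
Qed.

End Frege.

(** * Natural deduction with polynomial size bounds *)

Lemma fsize_disj_mem a s : a \in s -> fsize a <= fsize (disj s).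
Proof.
elim: s => //= b [|c s] IH; first by rewrite inE => /eqP->.
by rewrite inE => /orP[/eqP->|/IH] /=; lia.
Qed.

Lemma fsize_disj_size s : size s <= fsize (disj s).
Proof. by elim: s => //= a [|b s] /= IH; have := fsize_gt0 a; lia. Qed.

Lemma fsize_conj_size s : size s <= fsize (conj s).
Proof. by elim: s => //= a [|b s] /= IH; have := fsize_gt0 a; lia. Qed.

Lemma fsize_disj_le s K : {in s, forall a, fsize a <= K} ->
  fsize (disj s) <= (size s * K.+1).+1.
Proof.
elim: s => //= a [|b s] IH H; first by have := H a (mem_head _ _); lia.
have := H a (mem_head _ _).
have := IH (fun x h => H x (@mem_behead _ (a :: b :: s) x h)).
by rewrite /= !mulSn; lia.
Qed.

Lemma fsize_conj_le s K : {in s, forall a, fsize a <= K} ->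
  fsize (conj s) <= (size s * K.+1).+1.
Proof.
elim: s => //= a [|b s] IH H; first by have := H a (mem_head _ _); lia.
have := H a (mem_head _ _).
have := IH (fun x h => H x (@mem_behead _ (a :: b :: s) x h)).
by rewrite /= !mulSn; lia.
Qed.

Section Rules.
Variable F : seq rule.
Hypothesis hF : frege_system F.

Local Notation provN := (provN F).

Lemma provN_leq N N' G L : N <= N' -> provN N G L -> provN N' G L.
Proof. by move=> NN; apply: provN_weak. Qed.

Lemma provN1 N G a : provN N G (eq a) -> provN N G (inc [:: a]).
Proof. by apply: provN_weak => // b; rewrite /inc inE => /eqP->. Qed.

Lemma provN_cons N1 N2 G a l : provN N1 G (eq a) -> provN N2 G (inc l) ->
  provN (N1 + N2) G (inc (a :: l)).
Proof.
move=> H1 H2; apply: provN_weak (provN_union H1 H2) => // b.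
by rewrite /inc inE => /orP[/eqP->|]; [left|right].
Qed.

Lemma tautN G0 a0 : entails G0 a0 -> exists C, forall l K N G, 0 < K ->
  all (fun a => fsize a <= K) l ->
  provN N G (inc (map (subst (nth Top l)) G0)) ->
  provN (N + C * K) G (eq (subst (nth Top l) a0)).
Proof.
move=> /(schema hF)[C H]; exists C => l K N G K0 /allP lK HG.
have Hs x : fsize (nth Top l x) <= K.
  by case: (ltnP x (size l)) => xl; [apply/lK/mem_nth | rewrite nth_default].
have HG' := H _ _ K0 (fun x _ => Hs x).
apply: provN_weak (provN_cut HG (provN_weak (leqnn _) _ (fun _ x => x) HG')) => // b.
  by right.
by left.
Qed.

Lemma prov0 N (G : ctx) a : G a -> fsize a <= N -> provN N G (eq a).
Proof. by move=> Ga aN; apply: provN_weak (provN_hyp F Ga). Qed.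

Lemma disj_introN : exists C, forall K s a, fsize (disj s) <= K -> a \in s ->
  provN (C * (size s * K)) (eq a) (eq (disj s)).
Proof.
have [C1 H1] := @tautN [:: Var 0] (Or (Var 0) (Var 1))
  (fun v => ltac:(by rewrite /= andbT => ->)).
have [C2 H2] := @tautN [:: Var 1] (Or (Var 0) (Var 1))
  (fun v => ltac:(by rewrite /= andbT => ->; rewrite orbT)).
pose C := C1 + C2 + 1; exists C => K; elim=> // b [|c s] IH a sz.
  by rewrite inE => /eqP-> /=; apply: prov0 => //; rewrite /= in sz; rewrite /C; nia.
have K0 : 0 < K by move: sz => /=; lia.
have szK : all (fun a => fsize a <= K) [:: b; disj (c :: s)].
  by move: sz => /= sz; apply/and3P; split=> //; lia.
rewrite inE => /orP[/eqP->|].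
  apply: (provN_leq _ (H1 _ K K (eq b) K0 szK _)).
    by rewrite /C /= !mulSn; nia.
  by apply/provN1/prov0 => //; case/and3P: szK.
have szd : fsize (disj (c :: s)) <= K by case/and3P: szK.
move=> /(IH _ szd) /provN1 {}IH.
apply: provN_weak (H2 _ K _ (eq a) K0 szK IH) => //=.
by rewrite /C /= !mulSn; nia.
Qed.

Lemma disj_elimN : exists C, forall K s c, 0 < K -> fsize (disj s) <= K ->
  fsize c <= K -> provN (C * ((size s).+1 * K))
    (fun b => exists2 a, a \in s & b = Imp a c) (eq (Imp (disj s) c)).
Proof.
have [C1 H1] := @tautN [::] (Imp Bot (Var 0)) (fun v => ltac:(by [])).
have [C2 H2] := @tautN [:: Imp (Var 0) (Var 2); Imp (Var 1) (Var 2)]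
  (Imp (Or (Var 0) (Var 1)) (Var 2))
  (fun v => ltac:(by rewrite /=; case: (v 0); case: (v 1); case: (v 2))).
pose C := C1 + C2 + 3; exists C => K; elim=> [|b [|d s] IH] c K0 sz cK.
- have H := H1 [:: c] K 0 (fun b => exists2 a, a \in [::] & b = Imp a c) K0.
  apply: (provN_leq _ (H _ _)); rewrite /= ?cK //; first by rewrite /C; nia.
  exists [::]; split=> //; [exact: valid_nil|by rewrite proof_size_nil].
- apply: prov0; first by exists b; rewrite ?mem_head.
  by move: sz => /= ; rewrite /C; nia.
have szd : fsize (disj (d :: s)) <= K by move: sz => /=; lia.
have szK : all (fun a => fsize a <= K) [:: b; disj (d :: s); c].
  by rewrite /= in sz szd *; rewrite cK andbT; lia.
have {}IH := IH c K0 szd cK; set G := (fun _ => _).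
have Hb : provN (3 * K) G (eq (Imp b c)).
  apply: prov0; first by exists b; rewrite ?mem_head.
  by move: sz => /=; lia.
have {}IH : provN (C * ((size (d :: s)).+1 * K)) G (eq (Imp (disj (d :: s)) c)).
  by apply: provN_weak IH => // e [a ad ->]; exists a => //; rewrite inE ad orbT.
have := H2 _ K _ G K0 szK (provN_cons Hb (provN1 IH)).
by apply: provN_leq; rewrite /C /= !mulSn; nia.
Qed.

Lemma conj_elimN : exists C, forall K s a, fsize (conj s) <= K -> a \in s ->
  provN (C * (size s * K)) (eq (conj s)) (eq a).
Proof.
have [C1 H1] := @tautN [:: And (Var 0) (Var 1)] (Var 0)
  (fun v => ltac:(by rewrite /= andbT => /andP[])).
have [C2 H2] := @tautN [:: And (Var 0) (Var 1)] (Var 1)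
  (fun v => ltac:(by rewrite /= andbT => /andP[])).
pose C := C1 + C2 + 1; exists C => K; elim=> // b [|c s] IH a sz.
  by rewrite inE => /eqP-> /=; apply: prov0 => //; rewrite /= in sz; rewrite /C; nia.
have K0 : 0 < K by move: sz => /=; lia.
have szd : fsize (conj (c :: s)) <= K by move: sz => /=; lia.
have szK : all (fun a => fsize a <= K) [:: b; conj (c :: s)].
  by rewrite /= in sz szd *; lia.
set G := eq _; have Hyp : provN K G (inc [:: And b (conj (c :: s))]).
  by apply/provN1/prov0.
rewrite inE => /orP[/eqP->|ac].
  by apply: (provN_leq _ (H1 _ K K G K0 szK Hyp)); rewrite /C /= !mulSn; nia.
have HR := H2 _ K K G K0 szK Hyp.
have := provN_cut HR (provN_weak (leqnn _) _ (fun _ x => x) (IH a szd ac)).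
move=> H; apply: (provN_weak _ _ _ (H _)) => //; try by [left | right].
by rewrite /C /= !mulSn; nia.
Qed.

Lemma conj_introN : exists C, forall K s, 0 < K -> fsize (conj s) <= K ->
  provN (C * ((size s).+1 * K)) (inc s) (eq (conj s)).
Proof.
have [C1 H1] := @tautN [::] Top (fun v => ltac:(by [])).
have [C2 H2] := @tautN [:: Var 0; Var 1] (And (Var 0) (Var 1))
  (fun v => ltac:(by rewrite /= andbT)).
pose C := C1 + C2 + 3; exists C => K; elim=> [|b [|d s] IH] K0 sz.
- apply: (provN_leq _ (H1 [::] K 0 _ K0 _ _)) => //; first by rewrite /C; nia.
  by exists [::]; split=> //; [exact: valid_nil|rewrite proof_size_nil].
- apply: prov0; first by rewrite /inc mem_head.
  by move: sz => /= ; rewrite /C; nia.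
have szd : fsize (conj (d :: s)) <= K by move: sz => /=; lia.
have szK : all (fun a => fsize a <= K) [:: b; conj (d :: s)].
  by rewrite /= in sz szd *; lia.
have {}IH := IH K0 szd; set G := inc _.
have Hb : provN K G (eq b).
  by apply: prov0; [rewrite /G /inc mem_head | case/andP: szK].
have {}IH : provN (C * ((size (d :: s)).+1 * K)) G (eq (conj (d :: s))).
  by apply: provN_weak IH => // e He; rewrite /G /inc in_cons [e \in _]He orbT.
have := H2 _ K _ G K0 szK (provN_cons Hb (provN1 IH)).
by apply: provN_leq; rewrite /C /= !mulSn; nia.
Qed.

End Rules.

(** Entailments that [F] simulates at linear cost, not necessarily rules of [F]; [nd_taut] refers to
    them by position. *)
Definition tautologies : seq rule :=
  [:: ([:: Imp (Var 0) (Var 1); Var 0], Var 1);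
      ([:: And (Var 0) (Var 1)], Var 0);
      ([:: And (Var 0) (Var 1)], Var 1);
      ([:: Var 0; Var 1], And (Var 0) (Var 1));
      ([:: Var 0; Neg (Var 0)], Bot);
      ([:: Bot], Var 0);
      ([:: Imp (Var 0) Bot], Neg (Var 0));
      ([:: Imp (Neg (Var 0)) Bot], Var 0);
      ([:: Or (Var 0) (Var 1); Imp (Var 0) (Var 2); Imp (Var 1) (Var 2)], Var 2);
      ([:: Var 0], Or (Var 0) (Var 1));
      ([:: Var 1], Or (Var 0) (Var 1));
      ([::], Top);
      ([::], Or (Var 0) (Neg (Var 0)))].

Record cost_constant (F : seq rule) (C : nat) : Prop := CostConstant {
  cost_taut : forall r, r \in tautologies -> forall l K N G, 0 < K ->
    all (fun a => fsize a <= K) l ->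
    provN F N G (inc (map (subst (nth Top l)) r.1)) ->
    provN F (N + C * K) G (eq (subst (nth Top l) r.2));
  cost_ded : forall N h G L, 0 < N -> fsize h <= N -> provN F N (addc h G) L ->
    provN F (N * (C * N)) G (fun b => exists2 a, L a & b = Imp h a);
  cost_disj_intro : forall K s a, fsize (disj s) <= K -> a \in s ->
    provN F (C * (size s * K)) (eq a) (eq (disj s));
  cost_disj_elim : forall K s c, 0 < K -> fsize (disj s) <= K -> fsize c <= K ->
    provN F (C * ((size s).+1 * K)) (fun b => exists2 a, a \in s & b = Imp a c)
      (eq (Imp (disj s) c));
  cost_conj_elim : forall K s a, fsize (conj s) <= K -> a \in s ->
    provN F (C * (size s * K)) (eq (conj s)) (eq a);
  cost_conj_intro : forall K s, 0 < K -> fsize (conj s) <= K ->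
    provN F (C * ((size s).+1 * K)) (inc s) (eq (conj s)) }.

(** A threshold rather than one constant, because [C] is later enlarged to dominate the cost of the
    base case as well. *)
Lemma cost_constant_exists F : frege_system F ->
  exists C0, forall C, C0 <= C -> cost_constant F C.
Proof.
move=> hF.
have [C1 H1] : exists C, forall r, r \in tautologies -> forall l K N G, 0 < K ->
    all (fun a => fsize a <= K) l ->
    provN F N G (inc (map (subst (nth Top l)) r.1)) ->
    provN F (N + C * K) G (eq (subst (nth Top l) r.2)).
  have : {in tautologies, forall r : rule, entails r.1 r.2}.
    move=> r rt v; apply/implyP; move: r rt.
    apply: (allP (a := fun r : rule => all (eval v) r.1 ==> eval v r.2)).
    by rewrite /=; case: (v 0); case: (v 1); case: (v 2).
  elim: tautologies => [|r R IH] H; first by exists 0.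
  have [Cr Hr] := tautN hF (H r (mem_head _ _)).
  have [CR HR] := IH (fun x h => H x (@mem_behead _ (r :: R) x h)).
  exists (Cr + CR) => r'; rewrite inE => /orP[/eqP->|r'R] l K N G K0 lK p.
    by apply: provN_leq (Hr _ _ _ _ K0 lK p); nia.
  by apply: provN_leq (HR _ r'R _ _ _ _ K0 lK p); nia.
have [C2 H2] := deductionN hF.
have [C3 H3] := disj_introN hF.
have [C4 H4] := disj_elimN hF.
have [C5 H5] := conj_elimN hF.
have [C6 H6] := conj_introN hF.
exists (C1 + C2 + C3 + C4 + C5 + C6) => C HC; split.
- move=> r rt l K N G K0 lK p; apply: provN_leq (H1 _ rt _ _ _ _ K0 lK p).
  by rewrite leq_add2l leq_mul2r; lia.
- move=> N h G L N0 hN p; apply: provN_leq (H2 _ _ _ _ N0 hN p).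
  by rewrite leq_mul2l leq_mul2r; lia.
- move=> K s a sK p; apply: provN_leq (H3 _ _ _ sK p).
  by rewrite leq_mul2r; lia.
- move=> K s a K0 sK p; apply: provN_leq (H4 _ _ _ K0 sK p).
  by rewrite leq_mul2r; lia.
- move=> K s a sK p; apply: provN_leq (H5 _ _ _ sK p).
  by rewrite leq_mul2r; lia.
- move=> K s sK p; apply: provN_leq (H6 _ _ sK p).
  by rewrite leq_mul2r; lia.
Qed.

(** [M] is the parameter that grows with the input (it becomes [n + 2]), whereas [C] depends on [F]
    and [k] only. *)
Class setting (F : seq rule) (C M : nat) : Prop := Setting {
  setting_cost : cost_constant F C;
  setting_gt1 : 1 < M }.

Section NaturalDeduction.
Variables (F : seq rule) (C M : nat).
Context {FCM : setting F C M}.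
Let HC : cost_constant F C := setting_cost.
Let M1 : 1 < M := setting_gt1.

(* Polynomials in [M] for fixed [d]: one step of natural deduction takes
   derivations of size [bound d] to derivations of size [bound d.+1]. *)
Fixpoint bound d := if d is d'.+1 then (C + 5) * bound d' ^ 3 else M.

Arguments bound : simpl never.

Local Notation B := bound.

Lemma boundS d : B d.+1 = (C + 5) * (B d * (B d * B d)).
Proof. by rewrite /bound !expnS expn0 muln1. Qed.

Lemma bound_gt1 d : 1 < B d.
Proof. by elim: d => // d IH; rewrite boundS; nia. Qed.

Lemma bound_quad d x : x <= C + 5 -> x * (B d * B d) <= B d.+1.
Proof.
move=> xC; rewrite boundS; apply: leq_mul => //.
by rewrite leq_mul2l leq_pmulr ?orbT // ltnW // bound_gt1.
Qed.

Lemma bound_line d x : x <= (B d).+1 -> B d + C * (x * B d) <= B d.+1.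
Proof.
move=> xB; rewrite boundS; have := bound_gt1 d.
move: xB; set b := B d => xB b1.
have bb : b + b <= b * b by nia.
have xb : x * b <= b * (b * b).
  by apply: leq_trans (leq_mul xB (leqnn b)) _; rewrite mulSn; nia.
have bbb : b * b <= b * (b * b) by rewrite leq_pmull // ltnW.
by rewrite mulnDl; apply: leq_trans (_ : b * (b * b) + C * (b * (b * b)) <= _); 
  [apply: leq_add; [lia | rewrite leq_mul2l xb orbT] | lia].
Qed.

Lemma bound_mul d : B d * B d <= B d.+1.
Proof. by rewrite boundS; have := bound_gt1 d; nia. Qed.

Lemma bound_leS d : B d <= B d.+1.
Proof. by have := bound_mul d; have := bound_gt1 d; nia. Qed.

Lemma bound_le d e : d <= e -> B d <= B e.
Proof.
elim: e => [|e IH]; first by rewrite leqn0 => /eqP->.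
by rewrite leq_eqVlt => /orP[/eqP->//|/IH]; have := bound_leS e; lia.
Qed.

Definition small d a := fsize a <= B d.
Definition nds d (G L : ctx) := provN F (B d) G L.
Definition nd d G a := nds d G (eq a).

Lemma small_le d e a : d <= e -> small d a -> small e a.
Proof. by move=> /bound_le H1; rewrite /small => /leq_trans; apply. Qed.

Lemma nds_le d e G L : d <= e -> nds d G L -> nds e G L.
Proof. by move=> /bound_le; apply: provN_leq. Qed.

Lemma nd_le d e G a : d <= e -> nd d G a -> nd e G a.
Proof. exact: nds_le. Qed.

Lemma nd_weak d (G G' : ctx) a : (forall b, G b -> G' b) -> nd d G a -> nd d G' a.
Proof. by move=> GG; apply: provN_weak. Qed.

Lemma nds_weak d (G G' L L' : ctx) : (forall b, G b -> G' b) ->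
  (forall b, L' b -> L b) -> nds d G L -> nds d G' L'.
Proof. by move=> GG LL; apply: provN_weak. Qed.

Lemma nd_hyp d (G : ctx) a : G a -> small d a -> nd d G a.
Proof. exact: prov0. Qed.

Lemma nds_small d G (L : ctx) a : nds d G L -> L a -> small d a.
Proof. by move=> [pf [_ H sz]] /H /proof_size_mem /leq_trans; apply. Qed.

Lemma nd_small d G a : nd d G a -> small d a.
Proof. by move=> /nds_small; apply. Qed.

Lemma nds_cut d G L L' : nds d G L -> nds d (unionc L G) L' -> nds d.+1 G L'.
Proof.
move=> H1 H2; apply: provN_weak (provN_cut H1 H2) => // [|b]; last by right.
by have := bound_mul d; have := bound_gt1 d; nia.
Qed.

Lemma nd_cut d G L a : nds d G L -> nd d (unionc L G) a -> nd d.+1 G a.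
Proof. exact: nds_cut. Qed.

Lemma nds_fam d (T : eqType) (xs : seq T) G (f : T -> ctx) :
  size xs <= B d -> (forall x, x \in xs -> nds d G (f x)) ->
  nds d.+1 G (fun b => exists2 x, x \in xs & f x b).
Proof.
move=> sz /provN_fam; apply: provN_leq; apply: leq_trans (bound_mul d).
by rewrite leq_mul2r sz orbT.
Qed.

Lemma nds_union d G L L' : nds d G L -> nds d G L' -> nds d.+1 G (unionc L L').
Proof.
move=> H1 H2; apply: provN_leq (provN_union H1 H2).
by have := bound_mul d; have := bound_gt1 d; nia.
Qed.

Fixpoint nd_all d G (l : seq formula) : Prop :=
  if l is b :: l' then nd d G b /\ nd_all d G l' else True.

Lemma nd_allE d G l : nd_all d G l -> provN F (size l * B d) G (inc l).
Proof.
elim: l => [_|a l IH [Ha /IH Hl]] /=.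
  by exists [::]; split; [exact: valid_nil | | rewrite proof_size_nil].
by rewrite mulSn; apply: provN_cons.
Qed.

Lemma nd_taut i l d G : i < size tautologies ->
  let r := nth ([::], Top) tautologies i in
  all (fun a => fsize a <= B d) l ->
  nd_all d G (map (subst (nth Top l)) r.1) -> nd d.+1 G (subst (nth Top l) r.2).
Proof.
move=> Hi /= lB /nd_allE p.
have B1 := bound_gt1 d.
have := cost_taut HC (mem_nth ([::], Top) Hi) (ltnW B1) lB p.
apply: provN_leq; rewrite size_map.
(* A generous bound on the number of premises; together with the cost [C] of the schema it stays
   below the factor [C + 5] in [bound]. *)
have sz : size (nth ([::], Top) tautologies i).1 <= 4.
  by move: i Hi {p} => [|[|[|[|[|[|[|[|[|[|[|[|[|]]]]]]]]]]]]].
rewrite -mulnDl; apply: leq_trans _ (bound_quad d (leqnn (C + 5))).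
by apply: leq_mul; [lia | nia].
Qed.

Lemma nd_mp d G a b : nd d G (Imp a b) -> nd d G a -> nd d.+1 G b.
Proof.
move=> H1 H2; apply: (@nd_taut 0 [:: a; b]) => //=.
have := nd_small H1; have := nd_small H2; rewrite /small /=; lia.
Qed.

Lemma nd_andl d G a b : nd d G (And a b) -> nd d.+1 G a.
Proof.
move=> H1; apply: (@nd_taut 1 [:: a; b]) => //=.
have := nd_small H1; rewrite /small /=; lia.
Qed.

Lemma nd_andr d G a b : nd d G (And a b) -> nd d.+1 G b.
Proof.
move=> H1; apply: (@nd_taut 2 [:: a; b]) => //=.
have := nd_small H1; rewrite /small /=; lia.
Qed.

Lemma nd_andi d G a b : nd d G a -> nd d G b -> nd d.+1 G (And a b).
Proof.
move=> H1 H2; apply: (@nd_taut 3 [:: a; b]) => //=.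
have := nd_small H1; have := nd_small H2; rewrite /small /=; lia.
Qed.

Lemma nd_nege d G a : nd d G a -> nd d G (Neg a) -> nd d.+1 G Bot.
Proof.
move=> H1 H2; apply: (@nd_taut 4 [:: a]) => //=.
have := nd_small H1; have := nd_small H2; rewrite /small /=; lia.
Qed.

Lemma nd_efq d G a : nd d G Bot -> small d a -> nd d.+1 G a.
Proof.
move=> H1 H2; apply: (@nd_taut 5 [:: a]) => //=.
by move: H2; rewrite /small => ->.
Qed.

Lemma nd_ori1 d G a b : nd d G a -> small d b -> nd d.+1 G (Or a b).
Proof.
move=> H1 H2; apply: (@nd_taut 9 [:: a; b]) => //=.
by have := nd_small H1; move: H2; rewrite /small => -> ->.
Qed.

Lemma nd_ori2 d G a b : nd d G b -> small d a -> nd d.+1 G (Or a b).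
Proof.
move=> H1 H2; apply: (@nd_taut 10 [:: a; b]) => //=.
by have := nd_small H1; move: H2; rewrite /small => -> ->.
Qed.

Lemma nd_top d G : nd d.+1 G Top.
Proof. exact: (@nd_taut 11 [::]). Qed.

Lemma nd_em d G a : small d a -> nd d.+1 G (Or a (Neg a)).
Proof. by move=> sa; apply: (@nd_taut 12 [:: a]) => //=; rewrite andbT. Qed.

Lemma nd_ded d h G a : nd d (addc h G) a -> small d h -> nd d.+1 G (Imp h a).
Proof.
have B1 := bound_gt1 d => H1 H2; have := cost_ded HC (ltnW B1) H2 H1.
apply: provN_weak => // [|b <-]; last by exists a.
by rewrite boundS; nia.
Qed.

Lemma nd_neg d G a : nd d (addc a G) Bot -> small d a -> nd d.+2 G (Neg a).
Proof.
move=> H1 H2; apply: (@nd_taut 6 [:: a]) => //=; last by split=> //; apply: nd_ded.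
by rewrite andbT; apply: (small_le (leqnSn d) H2).
Qed.

Lemma nd_raa d G a : nd d (addc (Neg a) G) Bot -> small d (Neg a) -> nd d.+2 G a.
Proof.
move=> H1 H2; apply: (@nd_taut 7 [:: a]) => //=; last by split=> //; apply: nd_ded.
by rewrite andbT; have := small_le (leqnSn _) H2; rewrite /small /=; lia.
Qed.

Lemma nd_or d G a b c : nd d G (Or a b) -> nd d (addc a G) c ->
  nd d (addc b G) c -> nd d.+2 G c.
Proof.
move=> H1 H2 H3; have /= szab := nd_small H1; have szc := nd_small H2.
rewrite /small /= in szab szc; have BS := bound_leS d.
apply: (@nd_taut 8 [:: a; b; c]) => //=; rewrite -/(B d.+1); first by lia.
by split; [apply: nd_le H1; lia | split; [|split=> //]; apply: nd_ded => //; rewrite /small; lia].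
Qed.

Lemma nd_disj d G s a : a \in s -> nd d G a -> small d (disj s) -> nd d.+1 G (disj s).
Proof.
move=> sa H1 H2; have szs := leq_trans (fsize_disj_size s) H2.
have H3 := cost_disj_intro HC H2 sa.
have H4 := provN_cut H1 (provN_weak (leqnn _) _ (fun _ x => x) H3).
apply: (provN_weak _ _ _ (H4 _)) => [|b|b|b ->] //; try by [right|left].
by apply: bound_line; apply: leqW.
Qed.

(** The number of cases is at most [B d] because the disjunction itself has at most that size, so a
    case distinction of growing length still costs four levels. *)
Lemma nd_disje d G s c : nd d G (disj s) ->
  (forall a, a \in s -> nd d (addc a G) c) -> small d c -> nd d.+4 G c.
Proof.
move=> H1 H2 szc; have sds := nd_small H1.
have szs := leq_trans (fsize_disj_size s) sds.
have B1 := bound_gt1 d; apply: (@nd_mp _ _ (disj s)); last by apply: nd_le H1; lia.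
apply: (@nd_cut _ _ (fun b => exists2 a, a \in s & b = Imp a c)).
  apply: (@nds_weak _ G _ (fun b => exists2 a, a \in s & Imp a c = b)) => //.
    by move=> b [a sa ->]; exists a.
  apply: nds_fam; first by apply: leq_trans szs _; apply: bound_leS.
  move=> a sa; apply: nd_ded; first exact: H2.
  exact: leq_trans (fsize_disj_mem sa) sds.
apply: (provN_weak _ _ _ (cost_disj_elim HC (ltnW B1) sds szc)) => //; last by left.
apply: leq_trans (bound_leS d.+1); apply: leq_trans (bound_line (x := (size s).+1) szs).
exact: leq_addl.
Qed.

Lemma nd_conj d G s : (forall a, a \in s -> nd d G a) -> small d (conj s) ->
  nd d.+2 G (conj s).
Proof.
move=> H1 H2; have szs := leq_trans (fsize_conj_size s) H2.
have B1 := bound_gt1 d.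
apply: (@nd_cut _ _ (fun b => exists2 a, a \in s & a = b)).
  exact: nds_fam.
have := cost_conj_intro HC (ltnW B1) H2.
apply: provN_weak => // [|b bs]; last by left; exists b.
by apply: leq_trans (bound_line (x := (size s).+1) szs); apply: leq_addl.
Qed.

Lemma nd_conje d G s a : nd d G (conj s) -> a \in s -> nd d.+1 G a.
Proof.
move=> H1 sa; have szs := leq_trans (fsize_conj_size s) (nd_small H1).
have H3 := cost_conj_elim HC (nd_small H1) sa.
have H4 := provN_cut H1 (provN_weak (leqnn _) _ (fun _ x => x) H3).
apply: (provN_weak _ _ _ (H4 _)) => [|b|b|b ->] //; try by [right|left].
by apply: bound_line; apply: leqW.
Qed.

Lemma small_disj d s : size s <= B d -> (forall a, a \in s -> small d a) ->
  small d.+1 (disj s).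
Proof.
move=> sz H; apply: leq_trans (fsize_disj_le H) _.
apply: leq_trans _ (bound_quad d (leq_addl C 5)); have := bound_gt1 d; nia.
Qed.

Lemma small_conj d s : size s <= B d -> (forall a, a \in s -> small d a) ->
  small d.+1 (conj s).
Proof.
move=> sz H; apply: leq_trans (fsize_conj_le H) _.
apply: leq_trans _ (bound_quad d (leq_addl C 5)); have := bound_gt1 d; nia.
Qed.

Lemma small_and d a b : small d a -> small d b -> small d.+1 (And a b).
Proof.
rewrite /small /=; have := bound_quad d (leq_addl C 5); have := bound_gt1 d; nia.
Qed.

Lemma small_or d a b : small d a -> small d b -> small d.+1 (Or a b).
Proof. exact: small_and. Qed.

Lemma small_imp d a b : small d a -> small d b -> small d.+1 (Imp a b).
Proof. exact: small_and. Qed.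

Lemma small_neg d a : small d a -> small d.+1 (Neg a).
Proof.
rewrite /small /=; have := bound_quad d (leq_addl C 5); have := bound_gt1 d; nia.
Qed.

Lemma small_var d x : small d (Var x).
Proof. exact: ltnW (bound_gt1 d). Qed.

End NaturalDeduction.

(** * Extension lists and the pigeonhole principle *)

Definition below b a := all (fun x => x < b) (vars a).

Lemma below_and b a c : below b (And a c) = below b a && below b c.
Proof. exact: all_cat. Qed.

Lemma below_or b a c : below b (Or a c) = below b a && below b c.
Proof. exact: all_cat. Qed.

Lemma below_imp b a c : below b (Imp a c) = below b a && below b c.
Proof. exact: all_cat. Qed.

Lemma below_neg b a : below b (Neg a) = below b a.
Proof. by []. Qed.

Lemma below_disj b s : below b (disj s) = all (below b) s.
Proof. by elim: s => //= a [|c s] <-; rewrite ?andbT ?below_or. Qed.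

Lemma below_conj b s : below b (conj s) = all (below b) s.
Proof. by elim: s => //= a [|c s] <-; rewrite ?andbT ?below_and. Qed.

(** Defined variables are numbered consecutively from [b], each by a formula in smaller variables,
    so the freshness conditions of extended Frege proofs become comparisons of numbers. *)
Fixpoint extension_list b (E : seq formula) : Prop :=
  if E is e :: E' then
    (exists2 c, e = Iff (Var b) c & below b c) /\ extension_list b.+1 E'
  else True.

Lemma extension_list_cat b E1 E2 :
  extension_list b E1 -> extension_list (b + size E1) E2 ->
  extension_list b (E1 ++ E2).
Proof.
elim: E1 b => [|e E1 IH] b /=; first by rewrite addn0.
by move=> [He H1]; rewrite addnS -addSn => H2; split=> //; apply: IH.
Qed.

Lemma below_le b b' a : b <= b' -> below b a -> below b' a.
Proof. by move=> bb; apply: sub_all => x /leq_trans; apply. Qed.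

Lemma extension_list_map b (X : Type) (xs : seq X) (c : X -> formula) q :
  (forall x, below b (c x)) ->
  map q xs = map Var (iota b (size xs)) ->
  extension_list b [seq Iff (q x) (c x) | x <- xs].
Proof.
elim: xs b => [|x xs IH] b //= Hc [-> Hq]; split; first by exists (c x).
by apply: IH => // y; apply: below_le (Hc y).
Qed.

Definition fresh_var (X : finType) b (x : X) := Var (b + enum_rank x).
Definition definitions (X : finType) b (c : X -> formula) :=
  [seq Iff (fresh_var b x) (c x) | x <- enum X].

Lemma definitions_extension (X : finType) b (c : X -> formula) :
  (forall x, below b (c x)) -> extension_list b (definitions b c).
Proof.
move=> Hc; apply: extension_list_map => //; rewrite -cardE.
rewrite /fresh_var (map_comp Var (fun x : X => b + enum_rank x)); congr map.
rewrite -[b in RHS]addn0 iotaDl (map_comp (addn b) (fun x : X => enum_rank x : nat)).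
have sz : size (enum X) = #|X| by rewrite -cardE.
congr map; apply: (@eq_from_nth _ 0) => [|i]; rewrite size_map ?size_iota sz // => Hi.
have x0 : X := enum_val (Ordinal Hi).
rewrite (nth_map x0) ?sz // nth_iota // add0n.
by rewrite -[nth _ _ i](enum_val_nth x0 (Ordinal Hi)) enum_valK.
Qed.

Lemma size_definitions (X : finType) b (c : X -> formula) :
  size (definitions b c) = #|X|.
Proof. by rewrite size_map -cardE. Qed.

Lemma fresh_var_below (X : finType) b (x : X) : below (b + #|X|) (fresh_var b x).
Proof. by rewrite /below /= ltn_add2l ltn_ord. Qed.

Lemma mem_definitions (X : finType) b (c : X -> formula) x :
  Iff (fresh_var b x) (c x) \in definitions b c.
Proof. by apply: map_f; rewrite mem_enum. Qed.

Section Pigeonhole.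
Variables (F : seq rule) (C M : nat).
Context {FCM : setting F C M}.

Local Notation B := (bound C M).
Local Notation small := (small C M).
Local Notation nd := (nd F C M).
Local Notation nds := (nds F C M).

Lemma nd_assum d h G : small d h -> nd d (addc h G) h.
Proof. by apply: nd_hyp; left. Qed.

Lemma nd_add d h G a : nd d G a -> nd d (addc h G) a.
Proof. by apply: nd_weak => b; right. Qed.

Lemma small_iff d a b : small d a -> small d b -> small d.+2 (Iff a b).
Proof. by move=> Ha Hb; apply: small_and => //; apply: small_imp. Qed.

Lemma nd_iffl d G a b : nd d G (Iff a b) -> nd d G a -> nd d.+2 G b.
Proof.
move=> H1 H2; apply: (nd_mp) (nd_le (leqnSn d) H2).
exact: (nd_andl H1).
Qed.

Lemma nd_iffr d G a b : nd d G (Iff a b) -> nd d G b -> nd d.+2 G a.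
Proof.
move=> H1 H2; apply: (nd_mp) (nd_le (leqnSn d) H2).
exact: (nd_andr H1).
Qed.

(** * The pigeonhole principle *)

Definition total_at (X : Type) (Y : finType) (P : X -> Y -> formula) x :=
  disj [seq P x y | y <- enum Y].

(** The relational form: a pigeon may occupy several holes, so a reduction to a smaller instance has
    no functionality to preserve. *)
Definition php_axioms (X : eqType) (Y : finType) (P : X -> Y -> formula) : ctx :=
  fun b => (exists x, b = total_at P x) \/
    (exists x x' y, x != x' /\ b = Neg (And (P x y) (P x' y))).

Lemma small_total d (X : Type) (Y : finType) (P : X -> Y -> formula) x :
  #|Y| <= B d -> (forall y, small d (P x y)) -> small d.+1 (total_at P x).
Proof.
move=> Yd Ps; apply: small_disj => // [|a /mapP[y _ ->]] //.
by rewrite size_map -cardE.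
Qed.

Lemma nd_total d G (X : Type) (Y : finType) (P : X -> Y -> formula) x y :
  nd d G (P x y) -> small d (total_at P x) -> nd d.+1 G (total_at P x).
Proof. by move=> H1 H2; apply: (nd_disj _ H1 H2); rewrite map_f ?mem_enum. Qed.

Lemma nd_totale d G (X : Type) (Y : finType) (P : X -> Y -> formula) x c :
  nd d G (total_at P x) -> (forall y, nd d (addc (P x y) G) c) -> small d c ->
  nd d.+4 G c.
Proof. by move=> H1 H2; apply: (nd_disje H1) => a /mapP[y _ ->]. Qed.

Lemma nd_clash d G a b : nd d G (Neg (And a b)) -> nd d G a -> nd d G b ->
  nd d.+2 G Bot.
Proof.
move=> HN Ha Hb; apply: (nd_nege _ (nd_le (leqnSn d) HN)).
exact: nd_andi.
Qed.

Lemma bound_cube d a b c : a <= B d -> b <= B d -> c <= B d -> a * b * c <= B d.+1.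
Proof.
move=> Ha Hb Hc; rewrite boundS; apply: leq_trans (leq_pmull _ _); last by lia.
by rewrite mulnA !leq_mul.
Qed.

(** The injectivity axioms are indexed by two pigeons and a hole; the cube in [bound] pays for this
    triple family in one level. *)
Lemma nds_php_axioms d G (X Y : finType) (P : X -> Y -> formula) :
  #|X| <= B d -> #|Y| <= B d -> (forall x, nd d.+1 G (total_at P x)) ->
  (forall x x' y, x != x' -> nd d.+1 G (Neg (And (P x y) (P x' y)))) ->
  nds d.+3 G (php_axioms P).
Proof.
move=> Xd Yd HT HN.
pose zs := [seq z : X * X * Y <- enum {: X * X * Y} | z.1.1 != z.1.2].
have szs : size zs <= B d.+1.
  rewrite size_filter; apply: leq_trans (count_size _ _) _.
  by rewrite -cardE !card_prod; apply: bound_cube.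
have H1 : nds d.+2 G (fun b => exists2 x, x \in enum X & total_at P x = b).
  apply: nds_fam => [|x _]; last exact: HT.
  by rewrite -cardE; apply: leq_trans Xd (bound_leS d).
have H2 : nds d.+2 G (fun b => exists2 z, z \in zs &
    Neg (And (P z.1.1 z.2) (P z.1.2 z.2)) = b).
  by apply: nds_fam => // z; rewrite mem_filter => /andP[zz _]; apply: HN.
apply: nds_weak (nds_union H1 H2) => // b [[x ->]|[x [x' [y [xx ->]]]]].
  by left; exists x => //; rewrite mem_enum.
by right; exists (x, x', y) => //; rewrite mem_filter xx mem_enum.
Qed.

(* Cook's reduction of the number of holes: a pigeon in the last hole moves to
   the hole of the last pigeon. *)
Definition php_def T (P : 'I_T.+2 -> 'I_T.+1 -> formula) (z : 'I_T.+1 * 'I_T) :=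
  Or (P (lift ord_max z.1) (lift ord_max z.2))
     (And (P (lift ord_max z.1) ord_max) (P ord_max (lift ord_max z.2))).

(** A pigeon in the last hole inherits the hole of the last pigeon, which injectivity keeps out of
    the last hole. Two pigeons in one new hole yield, in each of the four combinations of disjuncts,
    two distinct old pigeons in one old hole. *)
Lemma php_step T b d (P : 'I_T.+2 -> 'I_T.+1 -> formula) :
  T.+2 <= B d -> (forall x y, small d (P x y)) ->
  nds d.+4.+4.+4.+4.+4
    (unionc (inc (definitions b (php_def P))) (php_axioms P))
    (php_axioms (fun (x : 'I_T.+1) (y : 'I_T) => fresh_var b (x, y))).
Proof.
move=> Td Ps; set G := unionc _ _.
pose Q (x : 'I_T.+1) (y : 'I_T) := fresh_var b (x, y).
pose D := php_def P.
have sP e x y : d <= e -> small e (P x y) by move=> de; apply: (small_le de).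
have sD z : small d.+2 (D z).
  by apply: small_or; [apply: sP | apply: small_and].
have sE x y : small d.+4 (Iff (Q x y) (D (x, y))).
  by apply: small_iff => //; apply: small_var.
have axE e x y : d.+4 <= e -> nd e G (Iff (Q x y) (D (x, y))).
  move=> de; apply: nd_hyp; last exact: (small_le de).
  by left; apply: mem_definitions.
have axT e x : d.+4 <= e -> nd e G (total_at P x).
  move=> de; apply: nd_hyp; first by right; left; exists x.
  apply: (@small_le _ _ _ _ d.+1); first by lia.
  by apply: small_total; rewrite ?card_ord; last exact: Ps; lia.
have axN e x x' y : d.+4 <= e -> x != x' -> nd e G (Neg (And (P x y) (P x' y))).
  move=> de xx; apply: nd_hyp; first by right; right; exists x, x', y.
  apply: (@small_le _ _ _ _ d.+2); first by lia.
  by apply: small_neg => //; apply: small_and.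
have sTQ e x : d.+4 <= e -> small e (total_at Q x).
  move=> de; apply: (@small_le _ _ _ _ d.+1); first by lia.
  apply: small_total => [|y]; last exact: small_var.
  by rewrite card_ord; lia.
have totQ x : nd d.+4.+4.+4.+4 G (total_at Q x).
  apply: (nd_totale (axT _ (lift ord_max x) _)) => [|y'|]; try by [lia | apply: sTQ; lia].
  case: (unliftP ord_max y') => [y ->|->].
    apply: (nd_total (y := y)); last by apply: sTQ; lia.
    apply: (nd_iffr (nd_add _ (axE _ x y _))); first by lia.
    apply: nd_ori1; first by apply: nd_assum; apply: sP; lia.
    by apply: (@small_le _ _ _ _ d.+1); [lia | apply: small_and].
  apply: (nd_totale (nd_add _ (axT _ ord_max _))) => [|y''|]; try by [lia | apply: sTQ; lia].
  case: (unliftP ord_max y'') => [y ->|->].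
    apply: (nd_total (y := y)); last by apply: sTQ; lia.
    apply: (nd_iffr (nd_add _ (nd_add _ (axE _ x y _)))); first by lia.
    apply: nd_ori2; last by apply: sP; lia.
    by apply: nd_andi; [apply: nd_add|]; apply: nd_assum; apply: sP; lia.
  apply: nd_efq; last by apply: sTQ; lia.
  apply: (nd_clash (nd_add _ (nd_add _ (axN _ (lift ord_max x) ord_max ord_max _ _)))).
  - by lia.
  - by rewrite eq_sym neq_lift.
  - by apply: nd_add; apply: nd_assum; apply: sP; lia.
  - by apply: nd_assum; apply: sP; lia.
have injQ x x' y : x != x' -> nd d.+4.+4.+4.+4 G (Neg (And (Q x y) (Q x' y))).
  move=> xx; have sQQ : small d.+4.+4.+4.+2 (And (Q x y) (Q x' y)).
    by apply: small_and; apply: small_var.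
  apply: nd_neg => //; set H := And _ _.
  have HD z e : d.+4 <= e -> nd e.+1 (addc H G) (Q z y) ->
      nd e.+3 (addc H G) (D (z, y)).
    by move=> de HQ; apply: (nd_iffl _ HQ); apply: nd_add; apply: axE; lia.
  have H1 : nd d.+4.+4.+1 (addc H G) (D (x, y)).
    apply: HD; first by lia.
    by apply: (nd_andl (b := Q x' y)); apply: nd_assum; apply: small_and; apply: small_var.
  have H2 : nd d.+4.+4.+1 (addc H G) (D (x', y)).
    apply: HD; first by lia.
    by apply: (nd_andr (a := Q x y)); apply: nd_assum; apply: small_and; apply: small_var.
  have cl e h h' u u' v : d.+4 <= e -> u != u' ->
      nd e (addc h' (addc h (addc H G))) (P u v) ->
      nd e (addc h' (addc h (addc H G))) (P u' v) ->
      nd e.+2 (addc h' (addc h (addc H G))) Bot.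
    by move=> de uu; apply: nd_clash; do 3 apply: nd_add; apply: axN.
  have sA e z w : d < e -> small e (And (P z ord_max) (P ord_max w)).
    by move=> de; apply: (@small_le _ _ _ _ d.+1) => //; apply: small_and.
  apply: (nd_or (nd_le _ H1)); first by lia.
    apply: (nd_or (nd_add _ (nd_le _ H2))); first by lia.
      apply: (cl d.+4.+4 _ _ (lift ord_max x) (lift ord_max x') (lift ord_max y)).
      + by lia.
      + by rewrite (inj_eq lift_inj).
      + by apply: nd_add; apply: nd_assum; apply: sP; lia.
      + by apply: nd_assum; apply: sP; lia.
    apply: (cl d.+4.+4 _ _ (lift ord_max x) ord_max (lift ord_max y)).
    + by lia.
    + by rewrite eq_sym neq_lift.
    + by apply: nd_add; apply: nd_assum; apply: sP; lia.
    + by apply: (nd_andr (a := P (lift ord_max x') ord_max)); apply: nd_assum; apply: sA; lia.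
  apply: (nd_or (nd_add _ (nd_le _ H2))); first by lia.
    apply: (cl d.+4.+4 _ _ ord_max (lift ord_max x') (lift ord_max y)).
    + by lia.
    + by rewrite neq_lift.
    + by apply: (nd_andr (a := P (lift ord_max x) ord_max)); apply: nd_add;
        apply: nd_assum; apply: sA; lia.
    + by apply: nd_assum; apply: sP; lia.
  apply: (cl d.+4.+4 _ _ (lift ord_max x) (lift ord_max x') ord_max).
  + by lia.
  + by rewrite (inj_eq lift_inj).
  + by apply: (nd_andl (b := P ord_max (lift ord_max y))); apply: nd_add;
      apply: nd_assum; apply: sA; lia.
  + by apply: (nd_andl (b := P ord_max (lift ord_max y))); apply: nd_assum; apply: sA; lia.
apply: (@nds_le _ _ _ _ d.+4.+4.+4.+4.+2); first by lia.
apply: (nds_php_axioms (d := d.+4.+4.+4.+3)) => //; rewrite card_ord.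
  by apply: leq_trans (ltnW Td) _; apply: bound_le; lia.
by apply: leq_trans (ltnW (ltnW Td)) _; apply: bound_le; lia.
Qed.

Lemma proof_size_le K (E : seq formula) :
  (forall a, a \in E -> fsize a <= K) -> proof_size E <= size E * K.
Proof.
move=> H; rewrite /proof_size big_seq.
apply: (@leq_trans (\sum_(a <- E | a \in E) K)); first exact: leq_sum.
by rewrite -big_seq big_const_seq count_predT iter_addn_0 mulnC.
Qed.

(** The reduced instance consists of variables, hence is small at the same level [d]: all [T]
    reductions cost the same, and the costs add up instead of being iterated through [bound]. *)
Lemma pigeonhole_ord d T b (P : 'I_T.+1 -> 'I_T -> formula) :
  T.+1 <= B d -> (forall x y, small d (P x y)) -> (forall x y, below b (P x y)) ->
  exists E, [/\ extension_list b E, proof_size E <= T * B d.+4.+4.+4.+4.+4 &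
    provN F (T * B d.+4.+4.+4.+4.+4).+1 (unionc (inc E) (php_axioms P)) (eq Bot)].
Proof.
elim: T b P => [|T IH] b P Td Ps Pb.
  exists [::]; split=> //; first by rewrite proof_size_nil.
  (* With no hole left, [total_at] is the empty disjunction, which is [Bot] itself. *)
  apply: prov0 => //; right; left; exists ord0.
  by rewrite /total_at; case: (enum 'I_0) (size_enum_ord 0).
set W := B d.+4.+4.+4.+4.+4 in IH *.
pose E1 := definitions b (php_def P).
have E1b : extension_list b E1.
  apply: definitions_extension => z.
  by rewrite below_or below_and !Pb.
have [|||E2 [E2b E2s HE2]] := IH (b + size E1)
    (fun (x : 'I_T.+1) (y : 'I_T) => fresh_var b (x, y)).
- exact: ltnW.
- by move=> x y; apply: small_var.
- by move=> x y; rewrite size_definitions; apply: fresh_var_below.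
exists (E1 ++ E2); split; first exact: extension_list_cat.
  rewrite proof_size_cat mulSn leq_add //.
  apply: leq_trans (proof_size_le (K := B d.+4) _) _.
    move=> a /mapP[z _ ->]; apply: small_iff; first exact: small_var.
    apply: small_or; first exact: (small_le (leqnSn d)).
    exact: small_and.
  apply: leq_trans (leq_mul (_ : _ <= B d.+4) (leqnn _)) _; last first.
    by apply: leq_trans (bound_mul _) _; apply: bound_le; lia.
  rewrite size_definitions card_prod !card_ord.
  apply: (@leq_trans (B d * B d)); first by apply: leq_mul; lia.
  by apply: leq_trans (bound_mul _) _; apply: bound_le; lia.
have HE1 := php_step b Td Ps.
have H1 : provN F W (unionc (inc (E1 ++ E2)) (php_axioms P))
    (php_axioms (fun (x : 'I_T.+1) (y : 'I_T) => fresh_var b (x, y))).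
  apply: (provN_weak (leqnn W) _ _ HE1) => // a [Ha|Ha]; [left|by right].
  by rewrite /inc mem_cat [a \in E1]Ha.
have H2 := provN_cut H1 (provN_weak (leqnn _) _ (fun _ x => x) HE2).
rewrite mulSn -addnS; apply: (provN_weak _ _ _ (H2 _)) => // [a|a [Ha|Ha]].
- by right.
- by right; left; rewrite /inc mem_cat [a \in E2]Ha orbT.
- by left.
Qed.

Lemma pigeonhole d (Y : finType) b (P : 'I_#|Y|.+1 -> Y -> formula) :
  #|Y|.+1 <= B d -> (forall x y, small d (P x y)) -> (forall x y, below b (P x y)) ->
  exists E, [/\ extension_list b E, proof_size E <= B d.+4.+4.+4.+4.+4.+2 &
    nd d.+4.+4.+4.+4.+4.+2 (unionc (inc E) (php_axioms P)) Bot].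
Proof.
move=> Yd Ps Pb.
have [||E [Eb Es HE]] := pigeonhole_ord (b := b) Yd
  (P := fun x y => P x (enum_val y)); [by [] | by [] |].
set W := d.+4.+4.+4.+4.+4 in Es HE *.
have YW : #|Y| * B W < B W.+2.
  have YB : #|Y| <= B W by apply: leq_trans (ltnW Yd) _; apply: bound_le; rewrite /W; lia.
  apply: leq_ltn_trans (leq_mul YB (leqnn _)) _.
  apply: leq_ltn_trans (bound_mul W) _.
  have := @bound_mul _ _ _ FCM W.+1; have := @bound_gt1 _ _ _ FCM W.+1.
  by move: (B W.+1) (B W.+2) => u v; nia.
exists E; split=> //; first by apply: leq_trans Es _; apply: ltnW.
apply: provN_weak HE => // a [|Ha]; [by left|right].
case: Ha => [[x ->]|[x [x' [y [xx ->]]]]]; last by right; exists x, x', (enum_val y).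
left; exists x; rewrite /total_at; congr disj; rewrite (map_comp (P x)); congr map.
have sz : size (enum Y) = #|Y| by rewrite -cardE.
case: (pickP (xpredT : pred Y)) => [y0 _|Y0].
  apply: (@eq_from_nth _ y0) => [|i Hi]; first by rewrite size_map size_enum_ord sz.
  rewrite size_map size_enum_ord in Hi; rewrite (nth_map (Ordinal Hi)) ?size_enum_ord //.
  by rewrite (nth_ord_enum _ (Ordinal Hi)) (enum_val_nth y0).
have Y00 : #|Y| = 0 by apply: eq_card0 => y; have := Y0 y.
by rewrite (size0nil (etrans sz Y00)) (size0nil (s := enum 'I_#|Y|)) // size_enum_ord.
Qed.

End Pigeonhole.

(** * Large monochromatic families force a star *)

Definition coloring_axioms n c k (p : {set 'I_n} -> 'I_c -> formula) : ctx :=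
  fun b => (exists2 S : {set 'I_n}, #|S| = k & b = total_at p S) \/
    (exists (S T : {set 'I_n}) i, [/\ #|S| = k, #|T| = k, [disjoint S & T] &
       b = Neg (And (p S i) (p T i))]).

Definition star k n c (p : {set 'I_n} -> 'I_c -> formula) (i : 'I_c) (a : 'I_n) :=
  conj [seq Neg (p T i) | T : {set 'I_n} <- [seq T : {set _} <- vertices n k | a \notin T]].

Definition some_star k n c (p : {set 'I_n} -> 'I_c -> formula) :=
  disj [seq star k p z.1 z.2 | z <- enum {: 'I_c * 'I_n}].

(* [at_least j s]: at least [j] of the formulas [x 0, ..., x (s - 1)] hold. *)
Fixpoint at_least (x : nat -> formula) j s :=
  if j is j'.+1 then disj [seq And (x s') (at_least x j' s') | s' <- iota 0 s]
  else Top.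

Lemma mem_vertices n k (S : {set 'I_n}) : (S \in vertices n k) = (#|S| == k).
Proof. by rewrite mem_enum inE. Qed.

Section Star.
Variables (F : seq rule) (C M : nat).
Context {FCM : setting F C M}.

Local Notation B := (bound C M).
Local Notation small := (small C M).
Local Notation nd := (nd F C M).
Local Notation nds := (nds F C M).

Variables (k n c d : nat) (p : {set 'I_n} -> 'I_c -> formula).
Hypothesis n_le : n <= B d.
Hypothesis cd : c <= B d.
Hypothesis vd : size (vertices n k) <= B d.
Hypothesis ps : forall S i, small d (p S i).

Let small_p e S i : d <= e -> small e (p S i).
Proof. by move=> de; apply: (small_le de). Qed.

Lemma small_star e i a : d.+2 <= e -> small e (star k p i a).
Proof.
move=> de; apply: (small_le de); apply: small_conj => [|b /mapP[T _ ->]].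
  rewrite size_map size_filter; apply: leq_trans (count_size _ _) _.
  exact: leq_trans vd (bound_leS d).
by apply: small_neg.
Qed.

Lemma small_some_star e : d.+3 <= e -> small e (some_star k p).
Proof.
move=> de; apply: (small_le de); apply: small_disj => [|b /mapP[z _ ->]].
  rewrite size_map -cardE card_prod !card_ord.
  apply: leq_trans (leq_mul cd n_le) _; apply: leq_trans (bound_mul d) _.
  exact: bound_leS.
exact: small_star.
Qed.

Lemma nd_total_axiom e (G : ctx) (S : {set 'I_n}) :
  d.+1 <= e -> (forall b, coloring_axioms k p b -> G b) -> #|S| = k ->
  nd e G (total_at p S).
Proof.
move=> de GG Sk; apply: nd_hyp; first by apply: GG; left; exists S.
by apply: (small_le de); apply: small_total => //; rewrite card_ord.
Qed.

Lemma nd_disjoint e (G : ctx) (S T : {set 'I_n}) i :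
  d.+2 <= e -> (forall b, coloring_axioms k p b -> G b) ->
  #|S| = k -> #|T| = k -> [disjoint S & T] ->
  nd e G (p S i) -> nd e G (p T i) -> nd e.+2 G Bot.
Proof.
move=> de GG Sk Tk ST; apply: nd_clash; apply: nd_hyp.
  by apply: GG; right; exists S, T, i.
by apply: (small_le de); apply: small_neg; apply: small_and.
Qed.

(** A set of colour [i] avoiding [a] would be disjoint from a member of [us], which has colour [i]
    too; hence [a] is a centre. *)
Lemma nd_some_star e (G : ctx) (us : seq {set 'I_n}) i a :
  d.+3 <= e -> (forall b, coloring_axioms k p b -> G b) ->
  (forall S, S \in us -> #|S| = k /\ nd e G (p S i)) ->
  (forall T : {set 'I_n}, #|T| = k -> a \notin T ->
     exists2 S : {set 'I_n}, S \in us & [disjoint S & T]) ->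
  nd e.+4.+4 G (some_star k p).
Proof.
move=> de GG Hus HT; apply: (@nd_disj _ _ _ _ _ _ _ (star k p i a)).
- by apply/mapP; exists (i, a) => //; rewrite mem_enum.
- apply: (@nd_le _ _ _ _ e.+4.+2) => //; apply: nd_conj; last by apply: small_star; lia.
  move=> b /mapP[T]; rewrite mem_filter mem_vertices => /andP[aT /eqP Tk] ->.
  have [S Sus ST] := HT T Tk aT; have [Sk HS] := Hus S Sus.
  apply: nd_neg; last by apply: small_p; lia.
  apply: (nd_disjoint (i := i) _ _ Sk Tk ST); first by lia.
  + by move=> b' /GG; right.
  + exact: nd_add.
  + by apply: nd_assum; apply: small_p; lia.
- by apply: small_some_star; lia.
Qed.

(** * Counting the sets of each colour *)

Section Count.
Variables (K : nat) (S : nat -> {set 'I_n}).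
Let N := (#|{: 'I_c * 'I_K}|).+1.
Hypothesis NB : N <= B d.
Hypothesis Sk : forall s, s < N -> #|S s| = k.
(** The combinatorial input, kept abstract here; sunflowers in a linear family supply it, with [K]
    equal to [k * k]. *)
Hypothesis crowded : forall us, uniq us -> size us = K.+1 -> all (gtn N) us ->
  (exists u v, [/\ u \in us, v \in us & [disjoint S u & S v]]) \/
  (exists a : 'I_n, forall T : {set 'I_n}, #|T| = k -> a \notin T ->
     exists2 u, u \in us & [disjoint S u & T]).

Let x i s := p (S s) i.
Let Phi := some_star k p.

(** Written out, a threshold formula grows like the [j]-th power of [s]. This is polynomial because
    [j] stays within the fixed bound [K]; each layer costs two levels. *)
Lemma small_at_least e i j s : s <= N -> d + 2 * j <= e ->
  small e (at_least (x i) j s).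
Proof.
elim: j e s => [|j IH] e s sN de; first exact: small_var.
apply: (@small_le _ _ _ _ (d + 2 * j).+2); first by lia.
apply: small_disj => [|a /mapP[s']].
  rewrite size_map size_iota; apply: leq_trans sN _; apply: leq_trans NB _.
  by apply: bound_le; lia.
rewrite mem_iota => /andP[_ s's] ->; apply: small_and.
  by apply: small_p; lia.
by apply: IH; lia.
Qed.

(** Unfolding one layer of [at_least] names a further index of colour [i] below all those in [us],
    so [us] grows without repetition. After [j] layers it has [K + 1] members and [crowded]
    applies. *)
Lemma nd_crowd j e (G : ctx) i us s :
  d + 2 * K + 3 <= e -> (forall b, coloring_axioms k p b -> G b) ->
  s <= N -> uniq us -> all (fun u => s <= u < N) us -> size us + j = K.+1 ->
  (forall u, u \in us -> nd e G (x i u)) ->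
  nd e G (at_least (x i) j s) -> nd (e + 5 * j + 10) G Phi.
Proof.
elim: j e G us s => [|j IH] e G us s de GG sN uus /allP us_s szus Hus Hs.
  rewrite addn0 in szus.
  have usN : all (gtn N) us by apply/allP => u /us_s /andP[].
  have usk u : u \in us -> #|S u| = k by move=> /us_s /andP[_ /Sk].
  have [[u [v [uus' vus uv]]]|[a Ha]] := crowded uus szus usN.
    apply: (@nd_le _ _ _ _ e.+3); first by lia.
    apply: nd_efq; last by apply: small_some_star; lia.
    by apply: (nd_disjoint _ GG (usk u uus') (usk v vus) uv); [lia|apply: Hus..].
  apply: (@nd_le _ _ _ _ e.+4.+4); first by lia.
  apply: (nd_some_star (us := map S us) (i := i) (a := a)) => // [|U|T Tk aT].
  - by lia.
  - by move=> /mapP[u uu ->]; split; [apply: usk | apply: Hus].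
  - by have [u uu uT] := Ha T Tk aT; exists (S u) => //; apply: map_f.
apply: (@nd_le _ _ _ _ (e.+1 + 5 * j + 10).+4); first by lia.
apply: (nd_disje (nd_le _ Hs)); first by lia.
  move=> a /mapP[s']; rewrite mem_iota add0n => /andP[_ s's] ->.
  have Ha : nd e (addc (And (x i s') (at_least (x i) j s')) G)
                 (And (x i s') (at_least (x i) j s')).
    have jK : j <= K by lia.
    by apply: nd_assum; apply: (@small_le _ _ _ _ (d + 2 * j).+1);
      [lia | apply: small_and; [apply: small_p; lia | apply: small_at_least; lia]].
  apply: (IH _ _ (s' :: us) s').
  - by lia.
  - by move=> b /GG; right.
  - by lia.
  - rewrite /= uus andbT; apply/negP => /us_s; lia.
  - rewrite /= leqnn (leq_trans s's sN) /=.
    by apply/allP => u /us_s; lia.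
  - by move: szus => /=; lia.
  - move=> u; rewrite inE => /orP[/eqP->|/Hus Hu].
      exact: nd_andl Ha.
    by apply: nd_add; apply: (nd_le _ Hu); lia.
  - exact: nd_andr Ha.
by apply: small_some_star; lia.
Qed.

(* Pigeon [s] sits in hole [(i, j)]: it has colour [i], as have exactly [j]
   of its predecessors. *)
Definition slot i j s := And (x i s) (And (at_least (x i) j s) (Neg (at_least (x i) j.+1 s))).

Lemma small_slot e i j s : j < K -> s <= N -> d + 2 * K + 3 <= e ->
  small e (slot i j s).
Proof.
move=> jK sN de; apply: (@small_le _ _ _ _ (d + 2 * K).+3); first by lia.
apply: small_and; first by apply: small_p; lia.
apply: small_and; first by apply: small_at_least; lia.
by apply: small_neg; apply: small_at_least; lia.
Qed.

(** The earlier index [s] and its [j] predecessors of colour [i] make [j + 1] predecessors of [s'],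
    against the slot of [s']. *)
Lemma nd_slot_inj e G i j s s' : j < K -> s < s' -> s' <= N -> d + 2 * K + 3 <= e ->
  nd e G (slot i j s) -> nd e G (slot i j s') -> nd e.+4.+1 G Bot.
Proof.
move=> jK ss sN de H1 H2.
apply: (nd_nege (a := at_least (x i) j.+1 s')).
  apply: (@nd_disj _ _ _ _ _ _ _ (And (x i s) (at_least (x i) j s))).
  - by apply/mapP; exists s => //; rewrite mem_iota.
  - apply: nd_andi; first by apply: (nd_le _ (nd_andl H1)); lia.
    exact: nd_andl (nd_andr H1).
  - by apply: (@small_at_least _ i j.+1 s'); lia.
by apply: (nd_le _ (nd_andr (nd_andr H2))); lia.
Qed.

(** An ascent in [j] by excluded middle: either one more predecessor has the colour, or the count is
    exactly [j] and the slot is found. The assumed failure at [K] ends the ascent. *)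
Lemma nd_slot_total r e G (D : formula) i j s :
  j + r = K -> s <= N -> d + 2 * K + 3 <= e -> small e D ->
  nd e G (x i s) -> nd e G (Neg (at_least (x i) K s)) ->
  (forall j e' G', j < K -> e <= e' -> nd e' G' (slot i j s) -> nd e'.+1 G' D) ->
  nd e G (at_least (x i) j s) -> nd (e + 2 * r + 4) G D.
Proof.
move=> jr sN de sD Hx HK Hslot; elim: r j e G jr de sD Hx HK Hslot =>
  [|r IH] j e G jr de sD Hx HK Hslot Hj.
  rewrite addn0 in jr; rewrite jr in Hj.
  apply: (@nd_le _ _ _ _ e.+2); first by lia.
  by apply: nd_efq (small_le (leqnSn e) sD); apply: nd_nege HK.
apply: (@nd_le _ _ _ _ (e.+1 + 2 * r + 3).+2); first by lia.
have jK : j < K by lia.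
have sA : small e (at_least (x i) j.+1 s) by apply: small_at_least; lia.
apply: (nd_or (nd_le _ (nd_em G sA))); first by lia.
  apply: (@nd_le _ _ _ _ (e + 2 * r + 4)); first by lia.
  apply: (IH j.+1) => //; try exact: nd_add; first by lia.
  exact: nd_assum.
apply: (@nd_le _ _ _ _ e.+4); first by lia.
apply: (Hslot j e.+3) => //; first by lia.
rewrite /slot; apply: nd_andi; first by apply: nd_add; apply: (nd_le _ Hx); lia.
apply: nd_andi; first by apply: nd_add; apply: (nd_le _ Hj); lia.
by apply: nd_assum; apply: small_neg.
Qed.

(** A contradiction inside the calculus: under [Neg Phi] no set has [K] predecessors of its own
    colour, so every index finds a slot, and there is one index more than there are slots. *)
Lemma star_exists b : (forall S i, below b (p S i)) ->
  exists E, [/\ extension_list b E, proof_size E <= B (d + 10 * K + 50) &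
    nd (d + 10 * K + 50) (unionc (inc E) (coloring_axioms k p)) Phi].
Proof.
move=> pb; pose e0 := d + 2 * K + 3; pose P (s : 'I_N) (y : 'I_c * 'I_K) := slot y.1 y.2 s.
have sP e (s : 'I_N) y : e0 <= e -> small e (P s y).
  by move=> ee; apply: small_slot => //; rewrite ltnW.
have [|s y|s y|E [Eb Es HE]] := pigeonhole (d := e0) (b := b) (P := P).
- by apply: leq_trans NB _; apply: bound_le; rewrite /e0; lia.
- exact: sP.
- have al j t : below b (at_least (x y.1) j t).
    elim: j t => [|j IH] t //=; rewrite below_disj; apply/allP => a /mapP[t' _ ->].
    by rewrite below_and pb IH.
  by rewrite /P /slot !below_and pb below_neg !al.
exists E; split=> //.
  by apply: leq_trans Es _; apply: bound_le; rewrite /e0; lia.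
set G1 := addc (Neg Phi) (unionc (inc E) (coloring_axioms k p)).
have GG b' : coloring_axioms k p b' -> G1 b' by right; right.
have NP e : d.+4 <= e -> small e (Neg Phi).
  by move=> de; apply: (small_le de); apply: small_neg; apply: small_some_star.
apply: (@nd_le _ _ _ _ (d + 10 * K + 45).+2); first by lia.
apply: nd_raa; last first.
  by apply: NP; lia.
apply: (@nd_le _ _ _ _ (d + 10 * K + 40).+1); first by lia.
apply: (nd_cut (L := php_axioms P)); last first.
  apply: nd_weak (nd_le _ HE) => [a [Ha|Ha]|]; last by rewrite /e0; lia.
    by right; right; left.
  by left.
apply: (@nds_le _ _ _ _ (e0 + 7 * K + 30).+3); first by rewrite /e0; lia.
apply: nds_php_axioms => [||s|s s' y ss].
- by rewrite card_ord; apply: leq_trans NB _; apply: bound_le; rewrite /e0; lia.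
- by apply: leq_trans (ltnW NB) _; apply: bound_le; rewrite /e0; lia.
- have sN : s < N := ltn_ord s.
  have sT e : e0.+1 <= e -> small e (total_at P s).
    move=> ee; apply: (small_le ee); apply: small_total => [|y]; last exact: sP.
    by apply: leq_trans (ltnW NB) _; apply: bound_le; rewrite /e0; lia.
  apply: (@nd_le _ _ _ _ (e0 + 7 * K + 25).+4); first by lia.
  apply: (nd_totale (nd_total_axiom _ GG (Sk sN))) => [|i|]; last by apply: sT; lia.
    by rewrite /e0; lia.
  set G2 := addc _ G1.
  have Hx e : e0 <= e -> nd e G2 (x i s).
    by move=> ee; apply: nd_assum; apply: small_p; move: ee; rewrite /e0; lia.
  (* The set with index [s] is the first of the [K + 1] sets of colour [i]; [K] predecessors would
     complete the crowd and give [Phi]. *)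
  have HK : nd (e0 + 5 * K + 18) G2 (Neg (at_least (x i) K s)).
    have sA e : e0 <= e -> small e (at_least (x i) K s).
      by move=> ee; apply: small_at_least; [exact: ltnW | move: ee; rewrite /e0; lia].
    apply: (@nd_le _ _ _ _ (e0 + 5 * K + 12).+3); first by lia.
    apply: nd_neg; last by apply: sA; lia.
    apply: (@nd_le _ _ _ _ (e0 + 5 * K + 10).+1); first by lia.
    apply: (nd_nege (a := Phi)).
      apply: (nd_crowd (i := i) (us := [:: s : nat]) (s := s)) => //.
      + by move=> b' /GG; right; right.
      + exact: ltnW.
      + by rewrite /= leqnn sN.
      + by move=> u; rewrite inE => /eqP->; apply: nd_add; apply: Hx.
      + by apply: nd_assum; apply: sA.
    do 2 apply: nd_add; apply: nd_assum; apply: NP; rewrite /e0; lia.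
  apply: (@nd_le _ _ _ _ (e0 + 5 * K + 18 + 2 * K + 4)); first by lia.
  apply: (nd_slot_total (i := i) (j := 0) (s := s)) => //.
  + exact: ltnW.
  + by rewrite /e0; lia.
  + by apply: sT; lia.
  + by apply: Hx; lia.
  + move=> j e' G' jK ee Hs; apply: (nd_total (y := (i, Ordinal jK))) => //.
    by apply: sT; lia.
  + by rewrite addnS; apply: nd_top.
- apply: (@nd_le _ _ _ _ (e0 + 7 * K + 20).+2); first by lia.
  have ee : e0 <= e0 + 7 * K + 15 by lia.
  have [sl sl'] : nd (e0 + 7 * K + 15) (addc (And (P s y) (P s' y)) G1) (P s y) /\
             nd (e0 + 7 * K + 15) (addc (And (P s y) (P s' y)) G1) (P s' y).
    have H : nd (e0 + 7 * K + 14) (addc (And (P s y) (P s' y)) G1) (And (P s y) (P s' y)).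
      apply: nd_assum; apply: (@small_le _ _ _ _ e0.+1); first by lia.
      by apply: small_and; apply: sP.
    by split; rewrite addnS; [apply: nd_andl H | apply: nd_andr H].
  apply: nd_neg; last by apply: (@small_le _ _ _ _ e0.+1);
    [lia | apply: small_and; apply: sP].
  apply: (@nd_le _ _ _ _ (e0 + 7 * K + 15).+4.+1); first by lia.
  have jK := ltn_ord y.2.
  case: (ltngtP s s') => [lt|lt|/val_inj/eqP]; last by rewrite (negbTE ss).
    apply: (nd_slot_inj jK lt _ _ sl sl'); first exact: ltnW.
    by move: ee; rewrite /e0; lia.
  apply: (nd_slot_inj jK lt _ _ sl' sl); first exact: ltnW.
  by move: ee; rewrite /e0; lia.
Qed.

End Count.

End Star.

(** * Removing the centre of a star *)

(** A colouring may have several stars, while the new colouring must refer to a definite one; the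
    order of [zs] decides. *)
Definition first_true (X : eqType) (f : X -> formula) (zs : seq X) (z : X) :=
  And (f z) (Neg (disj [seq f w | w <- take (index z zs) zs])).

Section FirstTrue.
Variables (F : seq rule) (C M : nat).
Context {FCM : setting F C M}.

Local Notation B := (bound C M).
Local Notation small := (small C M).
Local Notation nd := (nd F C M).
Local Notation nds := (nds F C M).

Variables (d : nat) (X : eqType) (f : X -> formula) (zs : seq X).
Hypothesis fs : forall z, small d (f z).
Hypothesis zsd : size zs <= B d.
Hypothesis zsu : uniq zs.

Lemma small_disj_take e m : d.+1 <= e -> small e (disj (map f (take m zs))).
Proof.
move=> de; apply: (small_le de); apply: small_disj => [|a /mapP[w _ ->]] //.
by rewrite size_map size_take; case: ifP => // /ltnW /leq_trans; apply.
Qed.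

Lemma small_first_true e z : d.+3 <= e -> small e (first_true f zs z).
Proof.
move=> de; apply: (small_le de); apply: small_and.
  by apply: (@small_le _ _ _ _ d); [lia | apply: fs].
by apply: small_neg; apply: small_disj_take.
Qed.

Lemma small_disj_first_true e : d.+4 <= e -> small e (disj (map (first_true f zs) zs)).
Proof.
move=> de; apply: (small_le de); apply: small_disj => [|a /mapP[z _ ->]].
  by rewrite size_map; apply: leq_trans zsd _; apply: bound_le; lia.
exact: small_first_true.
Qed.

Lemma nd_first_true_uniq e G z w : d.+3 <= e -> z \in zs -> w \in zs -> z != w ->
  nd e G (first_true f zs z) -> nd e G (first_true f zs w) -> nd e.+3 G Bot.
Proof.
move=> de; wlog lt : z w / index z zs < index w zs.
  move=> H zz wz zw Hz Hw; case: (ltngtP (index z zs) (index w zs)) => [lt|lt|eqi].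
  - exact: (H z w).
  - by apply: (H w z) => //; rewrite eq_sym.
  - by case/eqP: zw; rewrite -(nth_index z zz) eqi nth_index.
move=> zz wz zw Hz Hw; apply: nd_nege (nd_le (leqnSn _) (nd_andr Hw)).
apply: nd_disj (nd_andl Hz) _; last by apply: small_disj_take; lia.
apply: map_f; rewrite -(nth_index z zz); set i := index z zs in lt *.
rewrite -(nth_take z lt); apply: mem_nth.
by rewrite size_takel // index_size.
Qed.

Lemma nd_first_true e G : d.+4 <= e -> nd e G (disj (map f zs)) ->
  nd (e + 20) G (disj (map (first_true f zs) zs)).
Proof.
move=> de Hf; set D := disj (map (first_true f zs) zs).
have sD e' : d.+4 <= e' -> small e' D by apply: small_disj_first_true.
have fs' e' z : d <= e' -> small e' (f z) by move=> de'; apply: (small_le de').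
(* A least-element principle by prefixes: the next formula is the first true one, or an earlier one
   holds and its implication is already available. The level [e + 10] is the same for every [m], and
   only the sizes add up. *)
have chain m : m <= size zs ->
    provN F (m * B (e + 10)) G (fun b => exists2 z, z \in take m zs & b = Imp (f z) D).
  elim: m => [_|m IH mz].
    by exists [::]; split=> [|b []|]; [exact: valid_nil|rewrite take0|rewrite proof_size_nil].
  have z0 : X by case: (zs) mz => // z.
  set z := nth z0 zs m.
  have zz : z \in zs by apply: mem_nth.
  have iz : index z zs = m by apply: index_uniq.
  have {}IH := IH (ltnW mz); set L := (fun b => _) in IH.
  have H : nd (e + 10) (unionc L G) (Imp (f z) D).
    have -> : e + 10 = (e.+1 + 3).+4.+2 by lia.
    apply: nd_ded; last by apply: fs'; lia.
    set G1 := addc _ _.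
    have sT : small (e + 2) (disj (map f (take m zs))) by apply: small_disj_take; lia.
    apply: (@nd_le _ _ _ _ (e + 7).+2); first by lia.
    apply: (nd_or (nd_le _ (nd_em G1 sT))); first by lia.
      apply: (@nd_le _ _ _ _ (e + 3).+4); first by lia.
      apply: nd_disje; last by apply: sD; lia.
        by apply: nd_assum; apply: small_disj_take; lia.
      move=> a /mapP[w wm ->]; apply: (@nd_le _ _ _ _ (e + 2).+1); first by lia.
      apply: (nd_mp (a := f w)); last by apply: nd_assum; apply: fs'; lia.
      do 2 apply: nd_add; apply: nd_add; apply: nd_hyp; first by left; exists w.
      by apply: (@small_le _ _ _ _ e.+1); [lia | apply: small_imp; [apply: fs'; lia | apply: sD]].
    apply: (@nd_le _ _ _ _ (e + 4).+2); first by lia.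
    apply: (@nd_disj _ _ _ _ _ _ _ (first_true f zs z)).
    - exact: map_f.
    - apply: nd_andi; first by apply: nd_add; apply: nd_assum; apply: fs'; lia.
      rewrite iz; apply: nd_assum; apply: (@small_le _ _ _ _ (e + 2).+1); first by lia.
      exact: small_neg.
    - by apply: sD; lia.
  rewrite mulSn addnC; apply: provN_weak (provN_cut IH H) => // b [w].
  rewrite (take_nth z0 mz) mem_rcons inE => /orP[/eqP->|wm] ->; first by right.
  by left; exists w.
have chainT := chain (size zs) (leqnn _).
apply: (@nd_le _ _ _ _ (e + 14).+4.+1); first by lia.
apply: (nd_cut (L := fun b => exists2 z, z \in zs & b = Imp (f z) D)).
  apply: provN_weak chainT => // [|b [z zz ->]]; last by exists z; rewrite ?take_size.
  apply: (@leq_trans (B (e + 10).+1)); last by apply: bound_le; lia.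
  apply: leq_trans (bound_mul _); rewrite leq_mul2r (leq_trans zsd) ?orbT //.
  by apply: bound_le; lia.
apply: nd_disje; last by apply: sD; lia.
  apply: (nd_weak (G := G)); first by move=> b; right.
  by apply: (nd_le _ Hf); lia.
move=> a /mapP[z zz ->]; apply: (@nd_le _ _ _ _ (e + 13).+1); first by lia.
apply: (nd_mp (a := f z)); last by apply: nd_assum; apply: fs'; lia.
apply: nd_add; apply: nd_hyp; first by left; exists z.
by apply: (@small_le _ _ _ _ e.+1); [lia | apply: small_imp; [apply: fs'; lia | apply: sD]].
Qed.

End FirstTrue.

(** * The induced colouring on one point less *)

Section Restrict.
Variables (F : seq rule) (C M : nat).
Context {FCM : setting F C M}.

Local Notation B := (bound C M).
Local Notation small := (small C M).
Local Notation nd := (nd F C M).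
Local Notation nds := (nds F C M).

Lemma nds_coloring_axioms d G n c k (p : {set 'I_n} -> 'I_c -> formula) :
  size (vertices n k) <= B d -> c <= B d ->
  (forall S : {set 'I_n}, #|S| = k -> nd d.+1 G (total_at p S)) ->
  (forall (S T : {set 'I_n}) i, #|S| = k -> #|T| = k -> [disjoint S & T] ->
     nd d.+1 G (Neg (And (p S i) (p T i)))) ->
  nds d.+3 G (coloring_axioms k p).
Proof.
move=> vd cd HT HN.
pose zs := [seq z : {set 'I_n} * {set 'I_n} * 'I_c <-
  [seq (e, i) | e <- [seq (U, V) | U <- vertices n k, V <- vertices n k],
   i <- enum 'I_c] | [disjoint z.1.1 & z.1.2]].
have szs : size zs <= B d.+1.
  rewrite size_filter; apply: leq_trans (count_size _ _) _.
  by rewrite !size_allpairs size_enum_ord; apply: bound_cube.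
have H1 : nds d.+2 G (fun b => exists2 U, U \in vertices n k & total_at p U = b).
  apply: nds_fam => [|S]; first by apply: leq_trans vd (bound_leS d).
  by rewrite mem_vertices => /eqP; apply: HT.
have H2 : nds d.+2 G (fun b => exists2 z, z \in zs &
    Neg (And (p z.1.1 z.2) (p z.1.2 z.2)) = b).
  apply: nds_fam => // z; rewrite mem_filter => /andP[zz].
  case/allpairsP => -[e i] /= [/allpairsP[[S T] /= [Sv Tv ->]] _ ez].
  by move: zz; rewrite ez /= => zz; apply: HN => //; apply/eqP; rewrite -mem_vertices.
apply: nds_weak (nds_union H1 H2) => // b [[S Sk ->]|[S [T [i [Sk Tk ST ->]]]]].
  by left; exists S; rewrite ?mem_vertices ?Sk.
right; exists (S, T, i) => //; rewrite mem_filter ST /=.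
by apply: allpairs_f; rewrite ?mem_enum //; apply: allpairs_f; rewrite mem_vertices ?Sk ?Tk.
Qed.

Variables (k n c d : nat) (p : {set 'I_n.+1} -> 'I_c.+1 -> formula).
Hypothesis n_le : n.+1 <= B d.
Hypothesis cd : c.+1 <= B d.
Hypothesis vd : size (vertices n.+1 k) <= B d.
Hypothesis vd' : size (vertices n k) <= B d.
Hypothesis ps : forall S i, small d (p S i).

Let zs := enum {: 'I_c.+1 * 'I_n.+1}.
Let st (z : 'I_c.+1 * 'I_n.+1) := star k p z.1 z.2.
Let sel := first_true st zs.

(** For the selected star, [lift z.2] embeds the [n] points as those different from the centre, and
    [lift z.1] embeds the new colours as those different from the colour of the star. *)
Definition restrict_case (S : {set 'I_n}) (j : 'I_c) (z : 'I_c.+1 * 'I_n.+1) :=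
  And (first_true (fun z => star k p z.1 z.2) (enum {: 'I_c.+1 * 'I_n.+1}) z)
      (p (lift z.2 @: S) (lift z.1 j)).

Definition restrict_def (S : {set 'I_n}) (j : 'I_c) :=
  disj [seq restrict_case S j z | z <- enum {: 'I_c.+1 * 'I_n.+1}].

Lemma small_zs_star e z : d.+2 <= e -> small e (st z).
Proof. by move=> de; apply: (small_star (d := d)). Qed.

Lemma size_zs : size zs <= B d.+2.
Proof.
rewrite -cardE card_prod !card_ord; apply: leq_trans (leq_mul cd n_le) _.
by apply: leq_trans (bound_mul _) _; apply: bound_le.
Qed.

Lemma small_sel e z : d + 5 <= e -> small e (sel z).
Proof.
move=> de; apply: (small_first_true (d := d.+2)) => [w|||].
- exact: small_zs_star.
- exact: size_zs.
- exact: enum_uniq.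
- by lia.
Qed.

Lemma small_restrict_case e S j z : d + 6 <= e -> small e (restrict_case S j z).
Proof.
move=> de; apply: (@small_le _ _ _ _ (d + 5).+1); first by lia.
by apply: small_and; [apply: small_sel | apply: (@small_le _ _ _ _ d); [lia | apply: ps]].
Qed.

Lemma small_restrict_def e S j : d + 7 <= e -> small e (restrict_def S j).
Proof.
move=> de; apply: (@small_le _ _ _ _ (d + 6).+1); first by lia.
apply: small_disj => [|a /mapP[z _ ->]]; last exact: small_restrict_case.
by rewrite size_map; apply: leq_trans size_zs _; apply: bound_le; lia.
Qed.

(** Totality: the lifted copy of [S] avoids the centre, so its colour is not that of the star and
    comes from a new one. Properness: the selected star is unique, so disjoint sets of one new
    colour lift to disjoint sets of one old colour. *)
Lemma nds_restrict e G (q : {set 'I_n} -> 'I_c -> formula) :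
  d + 20 <= e ->
  (forall a, coloring_axioms k p a -> G a) ->
  (forall (S : {set 'I_n}) j, #|S| = k -> G (Iff (q S j) (restrict_def S j))) ->
  (forall S j, small d (q S j)) ->
  nd e G (some_star k p) -> nds (e + 60) G (coloring_axioms k q).
Proof.
move=> de GG Gq sq HPhi.
have sst := small_zs_star; have szs := size_zs; have ssel := small_sel.
have srcase := small_restrict_case; have srdef := small_restrict_def.
have uzs : uniq zs by apply: enum_uniq.
have zzs z : z \in zs by rewrite mem_enum.
have sp e' S i : d <= e' -> small e' (p S i) by move=> de'; apply: (small_le de').
have axq e' (S : {set 'I_n}) j : d + 9 <= e' -> #|S| = k ->
    nd e' G (Iff (q S j) (restrict_def S j)).
  move=> de' Sk; apply: nd_hyp; first exact: Gq.
  apply: (@small_le _ _ _ _ (d + 7).+2); first by lia.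
  by apply: small_iff; [apply: (@small_le _ _ _ _ d); [lia|] | apply: srdef].
have Hsel : nd (e + 20) G (disj (map sel zs)).
  by apply: (nd_first_true (d := d.+2)) => //; [move=> ?; apply: sst | lia].
have stq e' S : d.+1 <= e' -> small e' (total_at q S).
  move=> de'; apply: (small_le de'); apply: small_total => [|j]; last exact: sq.
  by rewrite card_ord; lia.
have cardlift (a : 'I_n.+1) (S : {set 'I_n}) : #|S| = k -> #|[set lift a x | x in S]| = k.
  by move=> <-; apply: card_imset; apply: lift_inj.
have notlift (a : 'I_n.+1) (S : {set 'I_n}) : a \notin [set lift a x | x in S].
  by apply/imsetP => -[x _ /eqP]; rewrite (negbTE (neq_lift _ _)).
apply: (@nds_le _ _ _ _ (e + 55).+3); first by lia.
apply: nds_coloring_axioms => [||S Sk|S T j Sk Tk ST].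
- by apply: leq_trans vd' _; apply: bound_le; lia.
- by apply: leq_trans (ltnW cd) _; apply: bound_le; lia.
- apply: (@nd_le _ _ _ _ (e + 50).+4); first by lia.
  apply: nd_disje; [apply: (nd_le _ Hsel); lia| |by apply: stq; lia].
  move=> b /mapP[z _ ->]; set G1 := addc _ G.
  have GG1 b' : coloring_axioms k p b' -> G1 b' by move/GG; right.
  have Hz e' : d + 5 <= e' -> nd e' G1 (sel z) by move=> de'; apply: nd_assum; apply: ssel.
  set U := [set lift z.2 x | x in S]; have Uk : #|U| = k by apply: cardlift.
  apply: (@nd_le _ _ _ _ (e + 40).+4); first by lia.
  apply: (nd_totale (nd_total_axiom _ ps _ GG1 Uk)) => [||i|]; try by lia.
    case: (unliftP z.1 i) => [j ->|->].
      apply: (@nd_le _ _ _ _ (e + 35).+1); first by lia.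
      apply: (nd_total (y := j)); last by apply: stq; lia.
      apply: (@nd_le _ _ _ _ (e + 30).+2); first by lia.
      apply: (nd_iffr (nd_add _ (nd_add _ (axq _ S j _ Sk)))); first by lia.
      apply: (@nd_le _ _ _ _ (e + 20).+1); first by lia.
      apply: (@nd_disj _ _ _ _ _ _ _ (restrict_case S j z)).
      - by apply: map_f; rewrite mem_enum.
      - apply: (@nd_le _ _ _ _ (e + 10).+1); first by lia.
        apply: nd_andi; first by apply: nd_add; apply: Hz; lia.
        by apply: nd_assum; apply: sp; lia.
      - by apply: srdef; lia.
    apply: (@nd_le _ _ _ _ (e + 10).+2); first by lia.
    apply: nd_efq; last by apply: stq; lia.
    apply: (nd_nege (a := p U z.1)); first by apply: nd_assum; apply: sp; lia.
    apply: nd_add; apply: (@nd_le _ _ _ _ (e + 5).+2); first by lia.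
    apply: (nd_conje (nd_andl (Hz _ _))); first by lia.
    apply/mapP; exists U => //; rewrite mem_filter mem_vertices Uk eqxx andbT.
    exact: notlift.
  by apply: stq; lia.
- apply: (@nd_le _ _ _ _ (e + 50).+2); first by lia.
  have sH e' : d.+1 <= e' -> small e' (And (q S j) (q T j)).
    by move=> de'; apply: (small_le de'); apply: small_and.
  apply: nd_neg; last by apply: sH; lia.
  set G1 := addc _ G.
  have HS : nd (e + 20).+2 G1 (restrict_def S j).
    apply: (nd_iffl (nd_add _ (axq _ S j _ Sk))); first by lia.
    apply: (@nd_le _ _ _ _ (e + 10).+1); first by lia.
    apply: (nd_andl (b := q T j)).
    by apply: nd_assum; apply: sH; lia.
  have HT : nd (e + 20).+2 G1 (restrict_def T j).
    apply: (nd_iffl (nd_add _ (axq _ T j _ Tk))); first by lia.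
    apply: (@nd_le _ _ _ _ (e + 10).+1); first by lia.
    apply: (nd_andr (a := q S j)).
    by apply: nd_assum; apply: sH; lia.
  apply: (@nd_le _ _ _ _ (e + 40).+4); first by lia.
  apply: (nd_disje (nd_le _ HS)); [by lia| |exact: small_var].
  move=> _ /mapP[z _ ->]; apply: (@nd_le _ _ _ _ (e + 30).+4); first by lia.
  apply: (nd_disje (nd_add _ (nd_le _ HT))); [by lia| |exact: small_var].
  move=> _ /mapP[w _ ->]; set G2 := addc _ _.
  have Hz : nd (e + 20) G2 (restrict_case S j z).
    by apply: nd_add; apply: nd_assum; apply: srcase; lia.
  have Hw : nd (e + 20) G2 (restrict_case T j w) by apply: nd_assum; apply: srcase; lia.
  have [zw|zw] := eqVneq z w; last first.
    apply: (@nd_le _ _ _ _ (e + 20).+4); first by lia.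
    apply: (nd_first_true_uniq (d := d.+2) _ _ _ _ _ _ zw (nd_andl Hz) (nd_andl Hw)) => //.
      by move=> ?; apply: sst.
    by lia.
  rewrite -zw in Hw; apply: (@nd_le _ _ _ _ (e + 20).+3); first by lia.
  apply: (nd_disjoint (i := lift z.1 j) ps _ _ (cardlift z.2 S Sk) (cardlift z.2 T Tk) _
    (nd_andr Hz) (nd_andr Hw)).
  + by lia.
  + by move=> a /GG; right; right; right.
  + by rewrite imset_disjoint //; apply: lift_inj.
Qed.

End Restrict.

(** * Linear families of sets *)

Section Crowded.
Variables (I : finType) (k N : nat) (S : nat -> {set I}).
Hypothesis k_gt0 : 0 < k.
Hypothesis Sk : forall u, u < N -> #|S u| = k.
Hypothesis linear : forall u v x y, u < N -> v < N -> u != v ->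
  x \in S u -> x \in S v -> y \in S u -> y \in S v -> x = y.

(** If [T] met every member, choosing a point of [T] in each would be injective, as two members
    share only [x], which is not in [T]; but there are more than [k] members. *)
Lemma sunflower_center x (ws : seq nat) (T : {set I}) :
  uniq ws -> all (gtn N) ws -> k < size ws -> {in ws, forall u, x \in S u} ->
  #|T| = k -> x \notin T -> exists2 u, u \in ws & [disjoint S u & T].
Proof.
move=> uws /allP wsN szws xws Tk xT; apply/hasP; apply: contraLR szws.
rewrite -all_predC -leqNgt => /allP meet.
pose g u := odflt x [pick y in S u :&: T].
have gP u : u \in ws -> (g u \in S u) /\ (g u \in T).
  move=> /meet /=; rewrite -setI_eq0 /g => /set0Pn[y yST].
  by case: pickP => [z|/(_ y)]; rewrite /= ?yST // inE => /andP[].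
have ug : uniq (map g ws).
  rewrite map_inj_in_uniq // => u v uw vw guv; apply/eqP; apply: contraT => uv.
  have [gu gT] := gP u uw; have [gv _] := gP v vw; rewrite -guv in gv.
  have e := linear (wsN _ uw) (wsN _ vw) uv gu gv (xws u uw) (xws v vw).
  by rewrite e (negbTE xT) in gT.
rewrite -Tk cardE -(size_map g); apply: uniq_leq_size => // y /mapP[u uw ->].
by rewrite mem_enum; case: (gP u uw).
Qed.

Lemma crowded_family us : uniq us -> size us = (k * k).+1 -> all (gtn N) us ->
  (exists u v, [/\ u \in us, v \in us & [disjoint S u & S v]]) \/
  (exists a, forall T : {set I}, #|T| = k -> a \notin T ->
     exists2 u, u \in us & [disjoint S u & T]).
Proof.
case: us => [//|s us] /= /andP[sus uus] [szus] /andP[sN usN].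
case: (boolP (has (fun u => [disjoint S s & S u]) us)) => [/hasP[u uu su]|].
  by left; exists s, u; rewrite mem_head inE uu orbT.
rewrite -all_predC => /allP meet; right.
pose cnt x := count (fun u => x \in S u) us.
(* Double counting: each of the [k * k] other sets meets [S s], whereas counts below [k] at its [k]
   points sum to at most [k * k.-1]. *)
have [x xs kx] : exists2 x, x \in S s & k <= cnt x.
  apply/exists_inP; apply: contraT; rewrite negb_exists_in => /forall_inP small.
  have : size us <= \sum_(x in S s) cnt x.
    have -> : \sum_(x in S s) cnt x = \sum_(x in S s) \sum_(u <- us) (x \in S u).
      by apply: eq_bigr => x _; rewrite /cnt -sum1_count big_mkcond;
        apply: eq_bigr => u _; case: ifP.
    rewrite -sum1_size exchange_big /= big_seq [leqRHS]big_seq; apply: leq_sum => u uu.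
    have := meet u uu; rewrite /= -setI_eq0 => /set0Pn[y]; rewrite inE => /andP[ys yu].
    by rewrite (bigD1 y) //= yu.
  rewrite szus leqNgt => /negP[]; apply: leq_ltn_trans (_ : k * k.-1 < _).
    rewrite -{1}(Sk sN) -sum_nat_const; apply: leq_sum => x /small.
    by rewrite -ltnNge; case: (k).
  by rewrite ltn_mul2l k_gt0 ltn_predL.
exists x => T Tk xT.
have [||||u] := @sunflower_center x (s :: filter (fun u => x \in S u) us) T _ _ _ _ Tk xT.
- by rewrite /= mem_filter negb_and sus orbT filter_uniq.
- rewrite /= sN; apply/allP => u; rewrite mem_filter => /andP[_].
  exact: (allP usN).
- by rewrite /= size_filter ltnS.
- by move=> u; rewrite inE mem_filter => /predU1P[->//|/andP[]].
rewrite inE mem_filter => /predU1P[->|/andP[_ uu]] ut.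
  by exists s; rewrite ?mem_head.
by exists u; rewrite // inE uu orbT.
Qed.

End Crowded.

Section Lines.
Variables (n k q : nat).
Hypothesis kqn : k * (k * q) <= n.+1.

Definition line_point s t := t * (k * q) + ((s %/ q) * t + s %% q).

(* The line with slope [s %/ q] and intercept [s %% q] in the grid
   [0, k) x [0, kq). *)
Definition line s : {set 'I_n.+1} := [set inord (line_point s t) | t : 'I_k].

(** The reason for the height [k * q] of the grid: a slope below [q] over [k] columns, plus an
    intercept below [q]. *)
Lemma line_height s t : s < q * q -> t < k -> (s %/ q) * t + s %% q < k * q.
Proof.
move=> sq tk; have q0 : 0 < q by case: (q) sq.
have a : s %/ q < q by rewrite ltn_divLR.
have b : s %% q < q by rewrite ltn_mod.
have : (s %/ q) * t <= q * t by rewrite leq_mul2r ltnW ?orbT.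
have : q * t.+1 <= q * k by rewrite leq_mul2l tk orbT.
rewrite (mulnC k q) mulnS => h1 h2; apply: leq_trans h1.
by rewrite -addnS addnC leq_add.
Qed.

Lemma line_point_lt s t : s < q * q -> t < k -> line_point s t < n.+1.
Proof.
move=> sq tk; apply: leq_trans kqn; have h := line_height sq tk.
have : t.+1 * (k * q) <= k * (k * q) by rewrite leq_mul2r tk orbT.
by rewrite mulSn /line_point; lia.
Qed.

Lemma line_point_inj s s' t t' : s < q * q -> s' < q * q -> t < k -> t' < k ->
  line_point s t = line_point s' t' ->
  t = t' /\ (s %/ q) * t + s %% q = (s' %/ q) * t + s' %% q.
Proof.
move=> sq sq' tk tk'; have h := line_height sq tk; have h' := line_height sq' tk'.
rewrite /line_point => e; have kq : 0 < k * q by apply: leq_ltn_trans h.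
have tt : t = t'.
  by have := congr1 (divn^~ (k * q)) e;
    rewrite /= !divnMDl // (divn_small h) (divn_small h') !addn0.
by split=> //; move: e; rewrite -tt => /addnI.
Qed.

Lemma card_line s : s < q * q -> #|line s| = k.
Proof.
move=> sq; rewrite card_imset ?card_ord // => t t' /(congr1 val).
by rewrite /= !inordK ?line_point_lt // => /line_point_inj[] // /val_inj.
Qed.

(** Common points in two different columns would determine the slope and then the intercept, hence
    the index. *)
Lemma line_linear u v x y : u < q * q -> v < q * q -> u != v ->
  x \in line u -> x \in line v -> y \in line u -> y \in line v -> x = y.
Proof.
move=> uq vq uv /imsetP[t _ ->] /imsetP[t' _ /(congr1 val)] + /imsetP[r _ ->]
  /imsetP[r' _ /(congr1 val)]; rewrite /= !inordK ?line_point_lt //.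
move=> /line_point_inj[] // _ et /line_point_inj[] // _ er.
congr inord; congr line_point; apply/eqP; apply: contraT => tr.
case/eqP: uv; rewrite (divn_eq u q) (divn_eq v q).
have tr' : (t : nat) != r by [].
have a : u %/ q = v %/ q by nia.
by rewrite a in et *; have /addnI -> := et.
Qed.

End Lines.

(** * Ky Fan's lemma for signed sets *)

Lemma odd_sum_involution (T : eqType) (W : seq T) (f : T -> nat) (h : T -> T) :
  uniq W ->
  (forall w, w \in W -> [/\ h w \in W, h (h w) = w, h w != w & f (h w) = f w]) ->
  odd (\sum_(w <- W) f w) = false.
Proof.
have [m] := ubnP (size W); elim: m W => // m IH [|w W] /= szW; first by rewrite big_nil.
move=> /andP[wW uW] H; have [hW hh hw fw] := H w (mem_head _ _).
have {}hW : h w \in W by move: hW; rewrite inE (negbTE hw).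
rewrite big_cons (perm_big _ (perm_to_rem hW)) big_cons /= fw addnA oddD addnn odd_double /=.
apply: IH; first by rewrite size_rem //; case: (W) hW szW => //= *; lia.
  exact: rem_uniq.
move=> v; rewrite mem_rem_uniq // inE => /andP[vhw vW].
have [hv hhv hvv fv] := H v (@mem_behead _ (w :: W) v vW); split=> //.
rewrite mem_rem_uniq // inE; apply/andP; split.
  apply: contraNneq wW => e; move: (congr1 h e); rewrite hhv hh => <-.
  exact: vW.
move: hv; rewrite inE => /predU1P[e|//].
by case/eqP: vhw; rewrite -e hhv.
Qed.

(** * Alternating label sequences and their facets *)

Fixpoint deletions (T : Type) (s : seq T) : seq (seq T) :=
  if s is x :: s' then s' :: map (cons x) (deletions s') else [::].

Lemma size_deletions (T : Type) (s : seq T) : size (deletions s) = size s.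
Proof. by elim: s => //= x s <-; rewrite size_map. Qed.

Lemma sum_deletions_rem (T : eqType) (f : seq T -> nat) (s : seq T) :
  (forall t t', perm_eq t t' -> f t = f t') ->
  \sum_(t <- deletions s) f t = \sum_(x <- s) f (rem x s).
Proof.
elim: s f => [|y s IH] f Hf; first by rewrite !big_nil.
rewrite /= !big_cons eqxx big_map (IH (f \o cons y)) => [|t t' tt]; last first.
  by apply: Hf; rewrite perm_cons.
congr (_ + _); apply: eq_big_seq => x xs /=; apply: Hf.
by case: eqP => [->|_]; [rewrite perm_sym perm_to_rem // | ].
Qed.

Lemma perm_sum_deletions (T : eqType) (f : seq T -> nat) (s s' : seq T) :
  (forall t t', perm_eq t t' -> f t = f t') -> perm_eq s s' ->
  \sum_(t <- deletions s) f t = \sum_(t <- deletions s') f t.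
Proof.
move=> Hf ss; rewrite !sum_deletions_rem // (perm_big _ ss) /=.
apply: eq_big_seq => x xs'; apply: Hf; have xs : x \in s by rewrite (perm_mem ss).
rewrite -(perm_cons x) -(permPl (perm_to_rem xs)) -(permPr (perm_to_rem xs')).
exact: ss.
Qed.

(* [(a, true)] stands for the label [+a] and [(a, false)] for [-a]. *)
Definition label := (nat * bool)%type.
Definition flip (x : label) : label := (x.1, ~~ x.2).
(** The tie-break between [-a] and [+a] makes the order antisymmetric, so that sorting depends only
    on the multiset of labels. *)
Definition label_le (x y : label) := (x.1 < y.1) || ((x.1 == y.1) && (x.2 ==> y.2)).

Lemma label_le_total : total label_le.
Proof. by move=> [a b] [a' b']; rewrite /label_le /=; case: ltngtP => //=; case: b; case: b'. Qed.

Lemma label_le_trans : transitive label_le.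
Proof.
move=> [a b] [a1 b1] [a2 b2]; rewrite /label_le /=.
by case: ltngtP => //=; case: ltngtP => //=; case: ltngtP => //=; case: b; case: b1; case: b2; lia.
Qed.

Lemma label_le_anti : antisymmetric label_le.
Proof.
move=> [a b] [a1 b1]; rewrite /label_le /=.
by case: ltngtP => //= ->; case: b; case: b1.
Qed.

(** The alternating simplices of Ky Fan's lemma; [m] carries the strict increase of absolute values
    along the recursion. *)
Fixpoint alternating m b (s : seq label) :=
  if s is x :: s' then [&& m <= x.1, x.2 == b & alternating x.1.+1 (~~ b) s']
  else true.

Definition consistent (s : seq label) := {in s &, forall x y, x.1 = y.1 -> x = y}.

(* An alternating sequence has exactly one facet that alternates and starts
   with the sign [b]; any other sequence has zero or two such facets. *)
Lemma odd_deletions_sorted m b s :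
  sorted label_le s -> consistent s -> all (fun x : label => m <= x.1) s ->
  odd (\sum_(t <- deletions s) alternating m b t)
    = alternating m b s (+) alternating m (~~ b) s.
Proof.
elim: s m b => [|y s IH] m b; first by rewrite big_nil addbb.
move=> /= ys cs /andP[my ms]; rewrite big_cons big_map /=.
have sorted_s := path_sorted ys.
have cs' : consistent s by move=> u v us vs; apply: cs; rewrite inE ?us ?vs orbT.
(* If the head has sign [b], facets containing it correspond to facets of the tail that start with
   the opposite sign; otherwise only the facet omitting the head can alternate from [b]. *)
have [allS|nall] := boolP (all (fun x : label => y.1 < x.1) s).
  have -> : alternating m b s = alternating y.1.+1 b s.
    by case: (s) ms allS => //= z s' /andP[-> _] /andP[-> _].
  have := IH y.1.+1 (~~ b) sorted_s cs' allS; rewrite negbK => IH'.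
  rewrite my /=; case: (y.2 =P b) => [->|/eqP yb] /=.
    rewrite -[b == ~~ b]/(_ == _); have -> : (b == ~~ b) = false by case: (b).
    by rewrite oddD IH' oddb addbF; case: (alternating _ b _); case: (alternating _ _ _).
  have -> : (y.2 == ~~ b) = true by case: (y.2) yb; case: (b).
  by rewrite big1 // addn0 oddb.
case: s {IH} => [|z s] //= in ys cs ms sorted_s cs' nall *.
(* By consistency a tie in absolute value is a repeated label. Facets keeping both copies do not
   alternate, and the two facets omitting one copy are equal and cancel. *)
have zy : z = y.
  apply/esym; apply: cs; rewrite ?mem_head ?inE ?eqxx ?orbT //.
  case/andP: ys => yz pz; apply/eqP; move: (yz); rewrite /label_le.
  case: ltngtP => //= lt _; case/negP: nall; rewrite lt /=.
  apply/allP => u us; have := order_path_min label_le_trans pz.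
  move=> /allP /(_ u us); rewrite /label_le; lia.
rewrite {}zy big_cons big_map [X in _ + (_ + X)]big1 => [|t _]; last first.
  by rewrite /= ltnn !andbF.
by rewrite /= addn0 addnn odd_double ltnn !andbF.
Qed.

Definition alternates b (l : seq label) := alternating 0 b (sort label_le l).

Lemma perm_alternates b l l' : perm_eq l l' -> alternates b l = alternates b l'.
Proof.
by move=> /(perm_sortP label_le_total label_le_trans label_le_anti); rewrite /alternates => ->.
Qed.

Lemma odd_deletions b l : consistent l ->
  odd (\sum_(t <- deletions l) alternates b t) = alternates b l (+) alternates (~~ b) l.
Proof.
move=> cl; have ps : perm_eq l (sort label_le l) by rewrite perm_sym perm_sort.
rewrite (perm_sum_deletions _ ps); last by move=> t t' /(perm_alternates b) ->.
have ss := sort_sorted label_le_total l.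
rewrite -odd_deletions_sorted //; first last.
- by apply/allP => x.
- by move=> x y; rewrite !mem_sort; apply: cl.
congr odd; apply: eq_big_seq => t.
move: (sort _ l) ss => s ss ts; congr (nat_of_bool _).
rewrite /alternates sorted_sort //; first exact: label_le_trans.
apply: (subseq_sorted label_le_trans _ ss).
elim: s t {ss} ts => //= x s IH t; rewrite inE => /predU1P[->|/mapP[u us ->]].
  exact: subseq_cons.
by rewrite /= eqxx; apply: IH.
Qed.

(** Flipping keeps the sorted order: in a consistent list, labels of equal absolute value are equal,
    so the tie-break never reverses anything. *)
Lemma alternates_flip b l : consistent l ->
  alternates b (map flip l) = alternates (~~ b) l.
Proof.
move=> cl; rewrite /alternates.
have -> : sort label_le (map flip l) = map flip (sort label_le l).
  apply: (sorted_eq label_le_trans label_le_anti (sort_sorted label_le_total _)).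
    rewrite sorted_map; have := sort_sorted label_le_total l.
    apply: (sub_in_sorted (P := mem l)) => [x y xl yl|]; last by apply/allP => x; rewrite mem_sort.
    rewrite /label_le /=; case: ltngtP => //= e; rewrite (cl x y) //.
    by rewrite !implybb.
  rewrite perm_sort; by apply: perm_map; rewrite perm_sym perm_sort.
elim: (sort _ _) 0 b => //= x s IH m b; rewrite IH negbK.
by congr [&& _, _ & _]; case: (x.2); case: (b).
Qed.

Lemma alternating_labels b m l : alternating m b l ->
  uniq (unzip1 l) /\ all (leq m) (unzip1 l).
Proof.
elim: l m b => //= x l IH m b /and3P[mx _ /IH[ul al]]; split.
  by rewrite ul andbT; apply/negP => /(allP al); rewrite ltnn.
by rewrite mx /=; apply: sub_all al => y; lia.
Qed.

Lemma alternates_uniq b l : alternates b l -> uniq (unzip1 l).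
Proof.
move=> /alternating_labels[+ _]; congr is_true; apply: perm_uniq.
by apply: perm_map; rewrite perm_sort.
Qed.

Lemma flipK : involutive flip.
Proof. by case=> a b; rewrite /flip /= negbK. Qed.

Lemma unzip1_flip w : unzip1 (map flip w) = unzip1 w.
Proof. by rewrite /unzip1 -map_comp. Qed.

(* A list of signed coordinates encodes the maximal chain of its prefixes, in
   which a prefix stands for the signed set of its members. *)
Definition flags d : seq (seq label) :=
  undup [seq zip p (tval s) | p <- permutations (iota 0 d), s <- enum {: d.-tuple bool}].

Lemma mem_flags d w : (w \in flags d) = perm_eq (unzip1 w) (iota 0 d).
Proof.
rewrite mem_undup; apply/allpairsP/idP => [[[p s] /= [+ _ ->]]|pw].
  rewrite mem_permutations => pp; rewrite unzip1_zip //.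
  by rewrite size_tuple (perm_size pp) size_iota.
have sz : size (unzip2 w) == d by rewrite size_map -(size_map fst) (perm_size pw) size_iota.
exists (unzip1 w, Tuple sz); rewrite mem_permutations mem_enum /= zip_unzip.
by [].
Qed.

(** Exchanging entries [i] and [i + 1] changes only the prefix of length [i + 1]: it passes to the
    other flag through the same interior facet. *)
Definition swap_at (T : Type) i (w : seq T) :=
  if drop i w is a :: b :: v then take i w ++ [:: b, a & v] else w.

Lemma perm_swap_at (T : eqType) i (w : seq T) : perm_eq (swap_at i w) w.
Proof.
rewrite /swap_at; case E: (drop i w) => [|a [|b v]] //.
rewrite -[X in perm_eq _ X](cat_take_drop i w) E perm_cat2l.
apply/permP => p /=; lia.
Qed.

Lemma swap_at_cat (T : Type) (u v : seq T) a b :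
  swap_at (size u) (u ++ [:: a, b & v]) = u ++ [:: b, a & v].
Proof. by rewrite /swap_at drop_size_cat // take_size_cat. Qed.

Lemma cat_pair_at (T : Type) i (w : seq T) : i.+1 < size w ->
  exists u a b v, w = u ++ [:: a, b & v] /\ size u = i.
Proof.
move=> iw; have := cat_take_drop i w; have := size_drop i w.
case: (drop i w) => [|a [|b v]] /=; try lia.
by move=> _ <-; exists (take i w), a, b, v; rewrite size_takel //; lia.
Qed.

Lemma nth_deletions (T : Type) i (s : seq T) : i < size s ->
  nth [::] (deletions s) i = take i s ++ drop i.+1 s.
Proof.
elim: s i => //= x s IH [|i] ilt /=; first by rewrite drop0.
by rewrite (nth_map [::]) ?size_deletions // IH.
Qed.

Lemma signs_unique (w : seq label) x y :
  uniq (unzip1 w) -> x \in w -> y \in w -> x.1 = y.1 -> x = y.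
Proof.
move=> uw xw yw e; have := nth_index x xw; have := nth_index x yw.
suff -> : index y w = index x w by move=> -> ->.
have xi : index x w < size w by rewrite index_mem.
have yi : index y w < size w by rewrite index_mem.
apply/eqP; rewrite -(nth_uniq (x.1) _ _ uw) ?size_map //.
by rewrite !(nth_map x) ?nth_index // e.
Qed.

Lemma odd_sum_eq (T : eqType) (W : seq T) (f g : T -> nat) :
  {in W, forall w, odd (f w) = odd (g w)} ->
  odd (\sum_(w <- W) f w) = odd (\sum_(w <- W) g w).
Proof.
move=> H; rewrite big_seq [in RHS]big_seq.
by elim/big_ind2: _ => // x y x' y' e e'; rewrite !oddD e e'.
Qed.

(** * The parity of the number of alternating flags *)

Section KyFan.
Variables (lam : seq label -> label) (n : nat).

Definition signed_set (w : seq label) := uniq (unzip1 w) && all (gtn n) (unzip1 w).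

Lemma signed_set_prefix u v : signed_set (u ++ v) -> signed_set u.
Proof.
rewrite /signed_set /unzip1 map_cat cat_uniq all_cat.
by case/andP=> /and3P[-> _ _] /andP[-> _].
Qed.

(** The hypotheses of Ky Fan's lemma for the barycentric subdivision of the boundary of the
    cross-polytope: [lam] depends on the signed set only, is antipodal, and gives no opposite labels
    within a chain. *)
Hypothesis lam_perm : forall w w', perm_eq w w' -> lam w = lam w'.
Hypothesis lam_flip : forall w, signed_set w -> w != [::] ->
  lam (map flip w) = flip (lam w).
Hypothesis lam_chain : forall u v, signed_set (u ++ v) -> u != [::] ->
  (lam u).1 = (lam (u ++ v)).1 -> lam u = lam (u ++ v).

(** The labels along the chain above [u]. With empty [u] the empty prefix gets no label, as only
    nonempty signed sets are vertices of the subdivision. *)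
Fixpoint labels u (w : seq label) :=
  if w is a :: w' then lam (rcons u a) :: labels (rcons u a) w' else [::].

Lemma labels_cat u w w' : labels u (w ++ w') = labels u w ++ labels (u ++ w) w'.
Proof.
elim: w u => [|a w IH] u /=; first by rewrite cats0.
by rewrite IH cat_rcons.
Qed.

Lemma size_labels u w : size (labels u w) = size w.
Proof. by elim: w u => //= a w IH u; rewrite IH. Qed.

Lemma perm_labels u u' w : perm_eq u u' -> labels u w = labels u' w.
Proof.
elim: w u u' => //= a w IH u u' uu.
have pa : perm_eq (rcons u a) (rcons u' a) by rewrite -!cats1 perm_cat2r.
by rewrite (lam_perm pa) (IH _ _ pa).
Qed.

Lemma mem_labels u w x : x \in labels u w ->
  exists2 i, i < size w & x = lam (u ++ take i.+1 w).
Proof.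
elim: w u => //= a w IH u; rewrite inE => /predU1P[->|/IH[i iw ->]].
  by exists 0 => //; rewrite take0 cats1.
by exists i.+1 => //; rewrite cat_rcons.
Qed.

Lemma labels_consistent w : signed_set w -> consistent (labels [::] w).
Proof.
move=> vw x y /mem_labels[i iw ->] /mem_labels[j jw ->] /=.
wlog ij : i j iw jw / i <= j.
  by move=> H; case: (leqP i j) => [|/ltnW] ij e; [apply: H | apply/esym/H].
have e : take j.+1 w = take i.+1 w ++ drop i.+1 (take j.+1 w).
  by rewrite -{1}(cat_take_drop i.+1 (take j.+1 w)) take_takel.
rewrite e; apply: lam_chain; last by case: (w) iw.
by rewrite -e; move: vw; rewrite -{1}(cat_take_drop j.+1 w) => /signed_set_prefix.
Qed.

Lemma labels_flip w : signed_set w -> labels [::] (map flip w) = map flip (labels [::] w).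
Proof.
have H u v : signed_set (u ++ v) -> labels (map flip u) (map flip v) = map flip (labels u v).
  elim: v u => //= a v IH u; rewrite -cat_rcons => vw; rewrite -map_rcons IH //.
  by rewrite lam_flip //; [exact: signed_set_prefix vw | case: (u)].
exact: (H [::]).
Qed.

Lemma flags_signed d w : d <= n -> w \in flags d -> signed_set w.
Proof.
rewrite mem_flags => dn pw; rewrite /signed_set (perm_uniq pw) iota_uniq.
by apply/allP => x; rewrite (perm_mem pw) mem_iota /=; lia.
Qed.

Lemma flags_flip d w : w \in flags d -> map flip w \in flags d.
Proof. by rewrite !mem_flags unzip1_flip. Qed.

Definition alternating_flags d := \sum_(w <- flags d) alternates true (labels [::] w).

(* Count the alternating facets of the flags of the hemisphere in which the
   last coordinate is positive: interior facets cancel in pairs, the boundary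
   facets are the flags of one dimension less. *)
Lemma odd_alternating_flagsS d : d < n ->
  odd (alternating_flags d.+1) = odd (alternating_flags d).
Proof.
move=> dn; pose H := [seq w <- flags d.+1 | (d, true) \in w].
have Hf w : w \in H -> w \in flags d.+1 by rewrite mem_filter => /andP[].
have Hs w : w \in H -> signed_set w by move=> /Hf; apply: flags_signed.
have uH : uniq H by rewrite filter_uniq // undup_uniq.
have dsign w : w \in flags d.+1 -> ((d, false) \in w) = ((d, true) \notin w).
  move=> wf; have := flags_signed dn wf; rewrite /signed_set => /andP[uw _].
  have : d \in unzip1 w by move: wf; rewrite mem_flags => /perm_mem ->; rewrite mem_iota; lia.
  case/mapP => -[e []] xw /= ed; rewrite -ed in xw.
    rewrite xw; apply/negP => yw; by have := signs_unique uw xw yw erefl.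
  by rewrite xw; apply/esym/negP => yw; have := signs_unique uw xw yw erefl.
have -> : odd (alternating_flags d.+1) =
  odd (\sum_(w <- H) \sum_(t <- deletions (labels [::] w)) alternates true t).
  (* A flag of the negative hemisphere is the flip of one in [H], and flipping exchanges the two
     starting signs. Modulo 2 the two terms form the right-hand side of [odd_deletions]. *)
  have -> : alternating_flags d.+1 =
      \sum_(w <- H) (alternates true (labels [::] w) + alternates false (labels [::] w)).
    rewrite /alternating_flags (bigID (fun w => (d, true) \in w)) big_split /=.
    rewrite -[X in X + _ = _]big_filter -[X in _ + X = _]big_filter -/H; congr (_ + _).
    have pH : perm_eq [seq w <- flags d.+1 | (d, true) \notin w] (map (map flip) H).
      apply: uniq_perm; first by rewrite filter_uniq // undup_uniq.
        by rewrite map_inj_uniq //; apply: inj_map; apply: can_inj flipK.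
      move=> w; rewrite mem_filter; apply/andP/mapP => [[dw wf]|[v vH ->]].
        exists (map flip w); last by rewrite mapK //; apply: flipK.
        rewrite mem_filter flags_flip // andbT.
        by rewrite -[(d, true)]flipK mem_map ?dsign //; apply: can_inj flipK.
      have := flags_flip (Hf v vH) => vf; split=> //.
      rewrite -dsign // -[(d, false)]flipK mem_map; last exact: can_inj flipK.
      by move: vH; rewrite mem_filter => /andP[].
    rewrite (perm_big _ pH) big_map; apply: eq_big_seq => w wH.
    by rewrite labels_flip ?Hs // alternates_flip //; apply: labels_consistent; apply: Hs.
  apply: odd_sum_eq => w wH; rewrite odd_deletions; last by apply: labels_consistent; apply: Hs.
  by rewrite oddD !oddb.
have szH w : w \in H -> size w = d.+1.
  by move=> /Hf; rewrite mem_flags => /perm_size; rewrite size_map size_iota.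
have -> : \sum_(w <- H) \sum_(t <- deletions (labels [::] w)) alternates true t =
  \sum_(0 <= i < d.+1) \sum_(w <- H)
     alternates true (take i (labels [::] w) ++ drop i.+1 (labels [::] w)).
  rewrite exchange_big /=; apply: eq_big_seq => w wH.
  rewrite (big_nth [::]) size_deletions size_labels szH //.
  rewrite big_nat [RHS]big_nat; apply: eq_bigr => i /andP[_ id].
  by rewrite nth_deletions // size_labels szH.
rewrite big_nat_recr //= oddD big_nat.
have swapP i w : i < d -> w \in H -> exists u a b v,
    [/\ w = u ++ [:: a, b & v], size u = i & uniq w].
  move=> id wH; have [|u [a [b [v [e su]]]]] := @cat_pair_at _ i w; first by rewrite szH.
  exists u, a, b, v; split=> //; have /andP[+ _] := Hs w wH.
  exact: map_uniq.
(* Interior facets: [swap_at i] alters only label [i], the one deleted, and stays within [H]. *)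
have -> : odd (\sum_(0 <= i < d | 0 <= i < d) \sum_(w <- H)
   alternates true (take i (labels [::] w) ++ drop i.+1 (labels [::] w))) = false.
  elim/big_ind: _ => // [x y ox oy|i id]; first by rewrite oddD ox oy.
  apply: (odd_sum_involution (h := swap_at i)) => // w wH.
  have [u [a [b [v [e su uw]]]]] := swapP i w id wH.
  have pw := perm_swap_at i w; split.
  - rewrite mem_filter (perm_mem pw) mem_flags (permPl (perm_map _ pw)).
    by move: wH; rewrite mem_filter mem_flags.
  - by rewrite e -su !swap_at_cat.
  - rewrite e -su swap_at_cat eqseq_cat // eqxx /= eqseq_cons.
    move: uw; rewrite e cat_uniq => /and3P[_ _ /= /andP[+ _]].
    by rewrite inE; case: eqVneq => // ->; rewrite eqxx.
  - rewrite e -su swap_at_cat !labels_cat /= !take_size_cat ?size_labels //.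
    rewrite !drop_cat size_labels ltnNge leqnSn /= subSnn /= ?drop0.
    have pab : perm_eq (rcons (rcons u b) a) (rcons (rcons u a) b).
      by rewrite -!cats1 -!catA perm_cat2l; apply/permP => p /=; lia.
    by rewrite (lam_perm pab) (perm_labels v pab).
rewrite /=.
have -> : \sum_(w <- H) alternates true
      (take d (labels [::] w) ++ drop d.+1 (labels [::] w)) =
    \sum_(w <- H) alternates true (labels [::] (take d w)).
  apply: eq_big_seq => w wH; rewrite drop_oversize ?size_labels ?szH // cats0.
  rewrite -[in LHS](cat_take_drop d w) labels_cat take_size_cat //.
  by rewrite size_labels size_takel // szH.
pose top (w : seq label) := last (0, true) w.
have Htop w : w \in H -> exists w' x, [/\ w = rcons w' x, size w' = d & take d w = w'].
  move=> /szH; case/lastP: w => // w' x; rewrite size_rcons => -[sz].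
  by exists w', x; split=> //; rewrite -cats1 take_size_cat.
rewrite (bigID (fun w => top w == (d, true))) /= oddD.
(* The facet omitting the full set: if the last entry is not [+d], reversing its sign gives another
   flag of [H] with the same facet. *)
have -> : odd (\sum_(w <- H | top w != (d, true)) alternates true (labels [::] (take d w))) = false.
  rewrite -big_filter.
  pose h (w : seq label) := rcons (take d w) (flip (top w)).
  apply: (odd_sum_involution (h := h)) => [|w]; first exact: filter_uniq.
  rewrite mem_filter => /andP[tw wH]; have [w' [x [e sz tk]]] := Htop w wH.
  have topw : top w = x by rewrite e /top last_rcons.
  have hw : h w = rcons w' (flip x) by rewrite /h tk topw.
  have takeh : take d (h w) = w' by rewrite hw -cats1 take_size_cat.
  have := wH; rewrite mem_filter => /andP[dw wf].
  have dw' : (d, true) \in w'.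
    by move: dw tw; rewrite topw e mem_rcons inE eq_sym => /orP[->|].
  have xd : x.1 != d.
    apply/eqP => xd; have /andP[uw _] := Hs w wH.
    have xw : x \in w by rewrite e mem_rcons mem_head.
    by move: tw; rewrite topw (signs_unique uw xw dw xd) eqxx.
  split.
  - rewrite mem_filter hw /top last_rcons; apply/andP; split.
      by apply: contraNneq xd => /(congr1 fst) /= ->.
    rewrite mem_filter mem_rcons inE dw' orbT mem_flags.
    have -> : unzip1 (rcons w' (flip x)) = unzip1 w by rewrite e /unzip1 !map_rcons.
    by rewrite mem_flags in wf.
  - by rewrite {1}/h takeh hw /top last_rcons flipK e.
  - rewrite hw e eqseq_rcons eqxx /=; case: (x) => p []; by rewrite /flip /= xpair_eqE andbF.
  - by rewrite takeh tk.
rewrite addbF /alternating_flags -big_filter.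
(* What survives lies on the equator: flags ending in [+d], whose remaining entries are the flags of
   dimension [d]. *)
have pH : perm_eq [seq w <- H | top w == (d, true)] [seq rcons w (d, true) | w <- flags d].
  apply: uniq_perm; first exact: filter_uniq.
    by rewrite map_inj_uniq ?undup_uniq // => u v /rcons_inj[].
  have last_iota v : perm_eq (unzip1 (rcons v (d, true))) (iota 0 d.+1) =
      perm_eq (unzip1 v) (iota 0 d).
    by rewrite /unzip1 map_rcons -addn1 iotaD -cats1 perm_cat2r.
  move=> w; rewrite mem_filter; apply/andP/mapP => [[/eqP tw wH]|[v vf ->]].
    have [w' [x [e sz tk]]] := Htop w wH; exists w'; last first.
      by rewrite e; congr rcons; rewrite -tw /top e last_rcons.
    move: wH; rewrite mem_filter => /andP[_]; rewrite !mem_flags e.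
    have -> : x = (d, true); [by rewrite -tw /top e last_rcons | by rewrite last_iota].
  rewrite /top last_rcons eqxx mem_filter mem_rcons mem_head mem_flags last_iota.
  by rewrite -mem_flags.
rewrite (perm_big _ pH) big_map; congr odd; apply: eq_big_seq => w wf.
rewrite -cats1 take_size_cat //.
by move: wf; rewrite mem_flags => /perm_size; rewrite size_map size_iota.
Qed.

(** The induction starts from the single empty flag, whose empty label list alternates. *)
Lemma odd_alternating_flags d : d <= n -> odd (alternating_flags d).
Proof.
elim: d => [|d IH] dn; last by rewrite odd_alternating_flagsS // IH // ltnW.
rewrite /alternating_flags (perm_big [:: [::]]) /= ?big_seq1 //.
apply: uniq_perm; rewrite ?undup_uniq // => w; rewrite mem_flags inE.
by case: w => // a w; rewrite -[RHS]/false; apply/negP => /perm_size.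
Qed.

Lemma ky_fan : exists w, [/\ signed_set w, size w = n & uniq (unzip1 (labels [::] w))].
Proof.
have := odd_alternating_flags (leqnn n).
have [/hasP[w wf aw] _|/hasPn none] :=
  boolP (has (fun w => alternates true (labels [::] w)) (flags n)).
  exists w; split; first exact: flags_signed wf.
    by move: wf; rewrite mem_flags => /perm_size; rewrite size_map size_iota.
  exact: alternates_uniq aw.
rewrite /alternating_flags big1_seq // => w /none; by case: (alternates _ _).
Qed.

End KyFan.

(** * The Lovasz-Kneser theorem *)

Lemma big_minn_attained (I : finType) (P : pred I) (f : I -> nat) m :
  \big[minn/m]_(i | P i) f i < m -> exists2 i, P i & f i = \big[minn/m]_(i | P i) f i.
Proof.
elim/big_rec: _ => [|i x Pi IH]; first by rewrite ltnn.
by rewrite /minn; case: ifP => [_ _|_ /IH]; first by exists i.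
Qed.

Lemma big_minn_inf (I : finType) (P : pred I) (f : I -> nat) m i :
  P i -> \big[minn/m]_(j | P j) f j <= f i.
Proof.
move=> Pi; rewrite -big_filter.
have : i \in [seq j <- index_enum I | P j] by rewrite mem_filter Pi mem_index_enum.
elim: (filter _ _) => // j s IH; rewrite inE big_cons geq_min => /predU1P[->|/IH ->].
  by rewrite leqnn.
by rewrite orbT.
Qed.

Section Kneser.
Variables (n k m : nat) (col : {set 'I_n} -> nat).
Hypothesis k_gt0 : 0 < k.
Hypothesis nkm : n = 2 * k - 2 + m + 1.
Hypothesis col_lt : forall U : {set 'I_n}, #|U| = k -> col U < m.
Hypothesis col_proper : forall U V : {set 'I_n}, #|U| = k -> #|V| = k ->
  [disjoint U & V] -> col U != col V.

Definition side b (w : seq label) : {set 'I_n} := [set i : 'I_n | (i : nat, b) \in w].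

(** The default [m], which is not a colour, marks a side without any [k]-subset. *)
Definition least_color b w :=
  \big[minn/m]_(U : {set 'I_n} | (#|U| == k) && (U \subset side b w)) col U.

(** A canonical sign for small signed sets: the sign at the largest coordinate, which is reversed by
    flipping. *)
Definition top_sign (w : seq label) := (\max_(x <- w) x.1, true) \in w.

(** Small sets take absolute values below [2 * k - 2] from their sizes, large sets the [m] values
    after that from colours. This makes [n - 1] values, one fewer than the length of a full flag. *)
Definition kneser_label (w : seq label) : label :=
  if size w < 2 * k - 1 then ((size w).-1, top_sign w)
  else if least_color true w < least_color false w
  then (2 * k - 2 + least_color true w, true)
  else (2 * k - 2 + least_color false w, false).

Lemma side_perm b w w' : perm_eq w w' -> side b w = side b w'.
Proof. by move=> ww; apply/setP => i; rewrite !inE (perm_mem ww). Qed.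

Lemma side_flip b w : side b (map flip w) = side (~~ b) w.
Proof.
apply/setP => i; rewrite !inE -[(_, b)]flipK mem_map //; exact: can_inj flipK.
Qed.

Lemma kneser_label_perm w w' : perm_eq w w' -> kneser_label w = kneser_label w'.
Proof.
move=> ww; rewrite /kneser_label /least_color /top_sign !(side_perm _ ww).
by rewrite (perm_size ww) (perm_mem ww) (perm_big _ ww).
Qed.

Lemma least_color_attained b w : least_color b w < m ->
  exists U : {set 'I_n}, [/\ #|U| = k, U \subset side b w & col U = least_color b w].
Proof. by move=> /big_minn_attained[U /andP[/eqP Uk Us] e]; exists U. Qed.

Lemma sides_disjoint w : signed_set n w -> [disjoint side true w & side false w].
Proof.
case/andP=> uw _; rewrite -setI_eq0; apply/set0Pn => -[i]; rewrite !inE => /andP[it ifa].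
by have := signs_unique uw it ifa erefl.
Qed.

(** Opposite sides of two members of a chain are disjoint, so equal least colours would be attained
    on two disjoint [k]-sets. *)
Lemma least_color_neq u v : signed_set n (u ++ v) -> forall b,
  least_color b u < m -> least_color b u != least_color (~~ b) (u ++ v).
Proof.
move=> uv b lt; apply/eqP => e; have [U [Uk Us eU]] := least_color_attained lt.
have [|V [Vk Vs eV]] := @least_color_attained (~~ b) (u ++ v); first by rewrite -e.
have Us' : U \subset side b (u ++ v).
  by apply: subset_trans Us _; apply/subsetP => i; rewrite !inE mem_cat => ->.
have := col_proper Uk Vk; rewrite eU eV e eqxx => /(_ _)/notF; apply.
apply: (disjointWl Us'); apply: (disjointWr Vs); have := sides_disjoint uv.
by case: b {lt e eU Us eV Vs Us'} => //; rewrite disjoint_sym.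
Qed.

Lemma card_sides w : signed_set n w -> #|side true w| + #|side false w| = size w.
Proof.
move=> sw; have := sides_disjoint sw; rewrite -cardsUI -setI_eq0 => /eqP ->.
rewrite cards0 addn0 cardE -(size_map val) -(size_map fst w); apply: perm_size.
have /andP[uw /allP wn] := sw; apply: uniq_perm => //.
  by rewrite map_inj_uniq ?enum_uniq //; apply: val_inj.
move=> x; apply/mapP/mapP => [[i]|[[y b] yw /= ->]].
  by rewrite mem_enum !inE => /orP[] iw ->; [exists (i : nat, true) | exists (i : nat, false)].
have yn : y < n by apply: (wn y); apply: (map_f fst yw).
exists (Ordinal yn) => //; rewrite mem_enum !inE /=.
by case: b yw => ->; rewrite ?orbT.
Qed.

(** Of [2 * k - 1] points in two sides, some side receives at least [k]. *)
Lemma least_color_lt w : signed_set n w -> 2 * k - 1 <= size w ->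
  (least_color true w < m) || (least_color false w < m).
Proof.
move=> sw szw; have H b : k <= #|side b w| -> least_color b w < m.
  move=> kb; have : 0 < #|[set U : {set 'I_n} | U \subset side b w & #|U| == k]|.
    by rewrite cards_draws bin_gt0.
  case/card_gt0P => U; rewrite inE => /andP[Us /eqP Uk].
  by apply: leq_ltn_trans (col_lt Uk); apply: big_minn_inf; rewrite Us Uk eqxx.
have := card_sides sw; have [kt|tk] := leqP k #|side true w|; first by rewrite H.
by move=> e; rewrite (H false) ?orbT //; lia.
Qed.

Lemma kneser_label_big w : signed_set n w -> 2 * k - 1 <= size w ->
  exists b, kneser_label w = (2 * k - 2 + least_color b w, b) /\ least_color b w < m.
Proof.
move=> sw szw; have H := least_color_lt sw szw; rewrite /kneser_label [size w < _]ltnNge szw /=.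
case: ltnP => [lt|le]; [exists true | exists false]; split=> //.
  by case/orP: H => H; [exact: H | exact: ltn_trans lt H].
by case/orP: H => H; [exact: leq_ltn_trans le H | exact: H].
Qed.

Lemma kneser_label_lt w : signed_set n w -> w != [::] -> (kneser_label w).1 < n.-1.
Proof.
move=> sw w0; case: (ltnP (size w) (2 * k - 1)) => sz.
  rewrite /kneser_label sz /=; have : size w != 0 by rewrite size_eq0.
  lia.
by have [b [-> lt]] := kneser_label_big sw sz; rewrite /=; lia.
Qed.

Lemma kneser_label_flip w : signed_set n w -> w != [::] ->
  kneser_label (map flip w) = flip (kneser_label w).
Proof.
move=> sw w0; rewrite /kneser_label size_map /least_color !side_flip -!/(least_color _ w).
case: ifP => szw.
  rewrite /flip /=; congr (_, _); rewrite /top_sign big_map /=.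
  set a := \max_(x <- w) _.
  have /andP[uw _] := sw.
  have [b ab] : exists b, (a, b) \in w.
    rewrite /a; elim: (w) w0 => // -[y b] [|z w'] IH _.
      by exists b; rewrite big_seq1 mem_head.
    have [//|b' zw] := IH _.
    rewrite big_cons /=; set r := \max_(_ <- _) _ in zw *.
    rewrite /maxn; case: ltnP => _; last by exists b; rewrite mem_head.
    by exists b'; rewrite inE zw orbT.
  have -> : ((a, true) \in map flip w) = ((a, false) \in w).
    rewrite -[(a, true)]flipK mem_map //; exact: can_inj flipK.
  apply/idP/idP => [af|].
    by apply/negP => at'; have := signs_unique uw af at' erefl.
  by case: b ab => // ->.
have szw' : 2 * k - 1 <= size w by rewrite leqNgt szw.
have neq : least_color true w != least_color false w.
  have sw' : signed_set n (w ++ [::]) by rewrite cats0.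
  have := @least_color_neq w [::] sw' true; have := @least_color_neq w [::] sw' false.
  rewrite cats0 /= => nf nt; case/orP: (least_color_lt sw szw') => [/nt//|/nf].
  by rewrite eq_sym.
by case: ltngtP neq => // _ _.
Qed.

(** Equal absolute values mean equal sizes for two small sets and cannot occur between a small and a
    large one; for two large sets [least_color_neq] excludes opposite signs. *)
Lemma kneser_label_chain u v : signed_set n (u ++ v) -> u != [::] ->
  (kneser_label u).1 = (kneser_label (u ++ v)).1 ->
  kneser_label u = kneser_label (u ++ v).
Proof.
move=> suv u0; have su : signed_set n u.
  exact: signed_set_prefix suv.
have szu : size u != 0 by rewrite size_eq0.
case: (ltnP (size (u ++ v)) (2 * k - 1)) => [szuv|szuv].
  have szu' : size u < 2 * k - 1 by move: szuv; rewrite size_cat; lia.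
  rewrite /kneser_label szuv szu' /= => e; have v0 : v = [::].
    by apply: size0nil; move: e; rewrite size_cat; lia.
  by rewrite v0 cats0.
have [b [-> lt]] := kneser_label_big suv szuv.
case: (ltnP (size u) (2 * k - 1)) => [szu'|szu'].
  by rewrite /kneser_label szu' /=; lia.
have [b' [-> lt']] := kneser_label_big su szu' => /= /addnI e.
have [bb|bb] := eqVneq b' b; first by rewrite -e bb.
have eb : b = ~~ b' by case: b b' bb {lt lt' e} => [] [].
by have := least_color_neq suv lt'; rewrite -eb e eqxx.
Qed.

Theorem lovasz_kneser : False.
Proof.
have [w [sw szw uw]] := ky_fan kneser_label_perm kneser_label_flip kneser_label_chain.
have : size (unzip1 (labels kneser_label [::] w)) <= size (iota 0 n.-1).
  apply: uniq_leq_size => // _ /mapP[x /mem_labels[i iw ->] ->].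
  rewrite mem_iota /=; apply: kneser_label_lt; last by case: (w) iw.
  by move: sw; rewrite -{1}(cat_take_drop i.+1 w) => /signed_set_prefix.
rewrite size_map size_labels szw size_iota; lia.
Qed.

End Kneser.

(** * Polynomial-size proofs *)

Section Validity.
Variables (n k c : nat) (v : {set 'I_n} -> 'I_c -> bool).
Hypothesis k_gt0 : 0 < k.
Hypothesis kn : 2 * k <= n.
Hypothesis cE : c = n - 2 * k + 1.

Lemma improper_coloring :
  (forall U : {set 'I_n}, #|U| = k -> exists i, v U i) ->
  exists (U V : {set 'I_n}) i, [/\ #|U| = k, #|V| = k, [disjoint U & V] & v U i && v V i].
Proof.
move=> tot.
pose bad := [exists z : {set 'I_n} * {set 'I_n} * 'I_c,
  [&& #|z.1.1| == k, #|z.1.2| == k, [disjoint z.1.1 & z.1.2] & v z.1.1 z.2 && v z.1.2 z.2]].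
have [/existsP[[[U V] i] /and4P[/eqP Uk /eqP Vk UV vv]]|/existsPn none] := boolP bad.
  by exists U, V, i.
(* An assignment may give a vertex several colours; one is picked. The default 0 concerns sets
   without a colour, hence no [k]-subset. *)
pose col (U : {set 'I_n}) := if [pick i | v U i] is Some i then nat_of_ord i else 0.
have colP (U : {set 'I_n}) : #|U| = k -> exists2 i : 'I_c, v U i & col U = i.
  move=> /tot [i vi]; rewrite /col; case: pickP => [j vj|/(_ i)]; last by rewrite vi.
  by exists j.
case: (@lovasz_kneser n k c col k_gt0 _ _ _).
- by rewrite cE; lia.
- by move=> U /colP[i _ ->].
- move=> U V Uk Vk UV; have [i vi ei] := colP U Uk; have [j vj ej] := colP V Vk.
  rewrite ei ej; apply/negP => /eqP/val_inj ij.
  have := none (U, V, i); rewrite /= Uk Vk eqxx UV vi ij vj //.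
Qed.

End Validity.

Lemma kneser_valid n k : 0 < k -> 2 * k <= n -> entails [::] (kneser n k).
Proof.
move=> k0 kn v _; rewrite /= eval_conj eval_disj; apply/implyP => /allP H.
pose w (U : {set 'I_n}) (i : 'I_(ncolors n k)) := eval v (pvar U i).
have [|U [V [i [Uk Vk UV /andP[vU vV]]]]] := @improper_coloring n k _ w k0 kn erefl.
  move=> U Uk; have /H : disj [seq pvar U i | i <- enum 'I_(ncolors n k)] \in
      [seq disj [seq pvar U i | i <- enum 'I_(ncolors n k)] | U <- vertices n k].
    by apply: map_f; rewrite mem_vertices Uk.
  by rewrite eval_disj => /hasP[_ /mapP[i _ ->] vi]; exists i.
apply/hasP; exists (disj [seq And (pvar U i) (pvar V i) | i <- enum 'I_(ncolors n k)]).
  apply/allpairsPdep; exists U, V; split=> //; first by rewrite mem_vertices Uk.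
  by rewrite mem_filter UV mem_vertices Vk eqxx.
rewrite eval_disj; apply/hasP; exists (And (pvar U i) (pvar V i)).
  by apply: map_f; rewrite mem_enum.
by rewrite /= -/(eval v (pvar U i)) [X in X && _]vU.
Qed.

Lemma subst_disj s l : subst s (disj l) = disj (map (subst s) l).
Proof. by elim: l => //= a [|b l] //= ->. Qed.

Definition coloring_axiom_list n c k (p : {set 'I_n} -> 'I_c -> formula) :=
  [seq total_at p U | U <- vertices n k] ++
  [seq Neg (And (p z.1.1 z.2) (p z.1.2 z.2)) |
     z : {set 'I_n} * {set 'I_n} * 'I_c <- enum {: {set 'I_n} * {set 'I_n} * 'I_c} &
     [&& #|z.1.1| == k, #|z.1.2| == k & [disjoint z.1.1 & z.1.2]]].

(** The base case of the rounds. Stated for arbitrary formulas [p], because the last round leaves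
    extension variables in place of the original ones. *)
Lemma coloring_refutation_const F n k c : frege_system F -> 0 < k -> 2 * k <= n ->
  c = n - 2 * k + 1 ->
  exists Cb, forall (p : {set 'I_n} -> 'I_c -> formula) K, 0 < K ->
    (forall U i, fsize (p U i) <= K) ->
    provN F (Cb * K) (coloring_axioms k p) (eq Bot).
Proof.
move=> hF k0 kn cE; pose g (U : {set 'I_n}) (i : 'I_c) := Var (pickle (U, i)).
have ent : entails (coloring_axiom_list k g) Bot.
  move=> v /allP H; pose w (U : {set 'I_n}) (i : 'I_c) := eval v (g U i).
  have [|U [V [i [Uk Vk UV /andP[vU vV]]]]] := @improper_coloring n k c w k0 kn cE.
    move=> U Uk; have /H : total_at g U \in coloring_axiom_list k g.
      by rewrite mem_cat map_f // mem_vertices Uk.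
    by rewrite eval_disj => /hasP[_ /mapP[i _ ->] vi]; exists i.
  have /H : Neg (And (g U i) (g V i)) \in coloring_axiom_list k g.
    rewrite mem_cat; apply/orP; right; apply/mapP; exists (U, V, i) => //.
    by rewrite mem_filter mem_enum /= Uk Vk eqxx UV.
  rewrite /= -/(eval v (g U i)) -/(eval v (g V i)).
  by move: vU vV; rewrite /w /= => -> ->.
have [Cb HCb] := schema hF ent; exists Cb => p K K0 pK.
pose s x := if unpickle x is Some z then p z.1 z.2 else Top.
have sg U i : subst s (g U i) = p U i by rewrite /= /s pickleK.
apply: provN_weak (HCb s K K0 _) => // [a|x _]; last first.
  by rewrite /s; case: unpickle => // -[U i].
rewrite /inc => /mapP[b + ->]; rewrite mem_cat => /orP[/mapP[U Uv ->]|/mapP[[[U V] i]]].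
  left; exists U; first by apply/eqP; rewrite -mem_vertices.
  rewrite subst_disj /total_at -map_comp; congr disj; apply: eq_map => i /=.
  by rewrite -[RHS]sg.
rewrite mem_filter => /andP[/and3P[/eqP Uk /eqP Vk UV] _] ->.
by right; exists U, V, i; split=> //; rewrite -!sg.
Qed.

Lemma size_vertices_le n k N : n <= N -> size (vertices n k) <= N ^ k.
Proof.
move=> nN; rewrite -cardE card_draws card_ord.
apply: leq_trans (leq_pmulr _ (fact_gt0 k)) _; rewrite bin_ffact ffact_prod.
rewrite -[X in N ^ X]card_ord -prod_nat_const; apply: leq_prod => i _.
exact: leq_trans (leq_subr _ _) nN.
Qed.

(** * Iterating the removal of a star *)

Section Loop.
Variables (F : seq rule) (C M : nat).
Context {FCM : setting F C M}.

Local Notation B := (bound C M).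
Local Notation small := (small C M).
Local Notation nd := (nd F C M).
Local Notation nds := (nds F C M).

Variables (k n0 c0 d : nat).
Hypothesis k_gt0 : 0 < k.
Hypothesis n0_ge : 2 * k ^ 6 <= n0.
Hypothesis c0n0 : c0 <= n0.

(** The last component bounds the number of pigeons, given that there are at most [n] colours. *)
Definition fits n := [/\ n <= B d, size (vertices n k) <= B d & (n * (k * k)).+1 <= B d].

(** The new colouring is small at the same level [d] as the old one, which is what allows the step
    to be repeated about [n] times. *)
Lemma coloring_step n c b (p : {set 'I_n.+1} -> 'I_c.+1 -> formula) :
  n0 <= n.+1 -> c.+1 <= n.+1 -> fits n.+1 -> fits n ->
  (forall U i, small d (p U i)) -> (forall U i, below b (p U i)) ->
  exists E q, [/\ extension_list b E,
    proof_size E <= B (d + 10 * (k * k) + 120),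
    nds (d + 10 * (k * k) + 120) (unionc (inc E) (coloring_axioms k p))
      (coloring_axioms k q),
    (forall U i, small d (q U i)) &
    (forall (U : {set 'I_n}) (i : 'I_c), below (b + size E) (q U i))].
Proof.
move=> nn0 cn [nB vB KB] [_ vB' _] ps pb.
(* The largest [q0] for which the grid of [k] columns of height [k * q0] fits into the [n + 1]
   points. *)
pose K := k * k; pose q0 := n.+1 %/ (k * k).
have K0 : 0 < K by rewrite muln_gt0 k_gt0.
have cB : c.+1 <= B d := leq_trans cn nB.
have kqn : k * (k * q0) <= n.+1 by rewrite mulnA mulnC; apply: leq_trunc_div.
have holes : #|{: 'I_c.+1 * 'I_K}| = c.+1 * K by rewrite card_prod !card_ord.
(* From $n+1 \ge 2K^3$ follows $q_0 \ge 2K^2$, so $q_0^2 \ge 2K^2 q_0 \ge K \cdot K(q_0+1) >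
   K(n+1)$, which covers the holes. *)
have enough : #|{: 'I_c.+1 * 'I_K}|.+1 <= q0 * q0.
  have q0K : 2 * (K * K) <= q0.
    rewrite leq_divRL // -/K; apply: leq_trans nn0; apply: leq_trans n0_ge.
    by rewrite /K !expnS expn0 muln1 -!mulnA.
  have nq : n.+1 < K * q0.+1 by rewrite mulnC; apply: ltn_ceil.
  have : c.+1 * K <= n.+1 * K by rewrite leq_mul2r cn orbT.
  have : K * n.+1 < K * (K * q0.+1) by rewrite ltn_mul2l K0.
  have : (2 * (K * K)) * q0 <= q0 * q0 by rewrite leq_mul2r q0K orbT.
  have : K * K * 1 <= K * K * q0.
    rewrite leq_mul2l; apply/orP; right; apply: leq_trans q0K.
    by rewrite muln_gt0 /= muln_gt0 K0.
  rewrite holes (mulnC n.+1) muln1 -(mulnA 2) mulnA mulnS; lia.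
have [|||E1 [E1b E1s HE1]] :=
  @star_exists F C M FCM k n.+1 c.+1 d p nB cB vB ps K (line n k q0) _ _ _ b pb.
- apply: leq_trans KB; rewrite holes ltnS.
  by rewrite leq_mul2r cn orbT.
- by move=> s sq; apply: card_line => //; apply: leq_trans enough.
- move=> us uus szus usN; apply: (crowded_family k_gt0) uus szus usN.
    by move=> u uN; apply: card_line => //; apply: leq_trans enough.
  move=> u v x y uN vN; apply: line_linear => //; exact: leq_trans enough.
pose X : finType := ({U : {set 'I_n} | #|U| == k} * 'I_c)%type.
pose b1 := b + size E1.
pose cdef (x : X) := restrict_def k p (val x.1) x.2.
pose E2 := definitions b1 cdef.
(* Only the [k]-subsets get a variable: there are too many other subsets. *)
pose q (U : {set 'I_n}) (i : 'I_c) :=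
  if insub U is Some u then fresh_var b1 ((u, i) : X) else Top.
have cardX : #|{: {U : {set 'I_n} | #|U| == k}}| <= B d.
  rewrite card_sig; apply: leq_trans vB'; rewrite -cardE.
  by apply/eq_leq/eq_card => U; rewrite !inE.
have st_below z : below b (star k p z.1 z.2).
  by rewrite below_conj; apply/allP => a /mapP[U _ ->]; rewrite below_neg.
have E2b : extension_list b1 E2.
  apply: definitions_extension => x; apply: (@below_le b); first exact: leq_addr.
  rewrite below_disj; apply/allP => a /mapP[z _ ->]; rewrite !below_and pb st_below.
  rewrite below_neg below_disj andbT /=; apply/allP => _ /mapP[w _ ->].
  exact: st_below.
set W := d + _ + _.
have E2s : proof_size E2 <= B (d + 20).
  apply: leq_trans (proof_size_le (K := B (d + 9)) _) _.
    move=> _ /mapP[x _ ->]; apply: (@small_le _ _ _ _ (d + 7).+2); first by lia.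
    apply: small_iff; first exact: small_var.
    rewrite /cdef; apply: (small_restrict_def (d := d)) => //.
  rewrite size_definitions card_prod card_ord.
  have := leq_mul cardX (ltnW cB); move=> H.
  apply: (@leq_trans (B (d + 9) * B (d + 9))).
    rewrite leq_mul2r; apply/orP; right; apply: leq_trans H _.
    by apply: leq_trans (bound_mul _) _; apply: bound_le; lia.
  by apply: leq_trans (bound_mul _) _; apply: bound_le; lia.
exists (E1 ++ E2), q; split.
- exact: extension_list_cat.
- rewrite proof_size_cat; apply: (@leq_trans (B (d + 10 * K + 60).+1)); last first.
    by apply: bound_le; rewrite /W; lia.
  have H1 : proof_size E1 <= B (d + 10 * K + 60) by apply: leq_trans E1s _; apply: bound_le; lia.
  have H2 : proof_size E2 <= B (d + 10 * K + 60) by apply: leq_trans E2s _; apply: bound_le; lia.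
  have := @bound_mul _ _ _ FCM (d + 10 * K + 60); have := @bound_gt1 _ _ _ FCM (d + 10 * K + 60).
  by nia.
- apply: (@nds_le _ _ _ _ (d + 10 * K + 50 + 60)); first by rewrite /W; lia.
  apply: (nds_restrict (d := d) (p := p)) => //.
  + by lia.
  + by move=> a Ha; right.
  + move=> U j Uk; left; rewrite /inc mem_cat; apply/orP; right.
    rewrite /q; case: insubP => [u _ uU|]; last by rewrite Uk eqxx.
    rewrite -uU; exact: (mem_definitions b1 cdef (u, j)).
  + by move=> U j; rewrite /q; case: insubP => [u _ _|_]; apply: small_var.
  + apply: nd_weak HE1 => a [Ha|Ha]; [left|by right].
    by rewrite /inc mem_cat [a \in E1]Ha.
- by move=> U j; rewrite /q; case: insubP => [u _ _|_]; apply: small_var.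
- move=> U j; rewrite size_cat addnA /E2 size_definitions /q.
  by case: insubP => [u _ _|_] //; apply: fresh_var_below.
Qed.

(** A round lowers the numbers of points and of colours together, so the relation between them
    persists down to [n0] and [c0]; the cost [B _] of a round is the same each time. *)
Lemma coloring_loop base r n c b (p : {set 'I_n} -> 'I_c -> formula) :
  (forall (p : {set 'I_n0} -> 'I_c0 -> formula), (forall U i, small d (p U i)) ->
     provN F base (coloring_axioms k p) (eq Bot)) ->
  n = r + n0 -> c = r + c0 -> (forall n', n' <= n -> fits n') ->
  (forall U i, small d (p U i)) -> (forall U i, below b (p U i)) ->
  exists E, [/\ extension_list b E,
    proof_size E <= r * B (d + 10 * (k * k) + 120) &
    provN F (r * B (d + 10 * (k * k) + 120) + base)
      (unionc (inc E) (coloring_axioms k p)) (eq Bot)].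
Proof.
move=> Hbase; elim: r n c b p => [|r IH] n c b p en ec fit ps pb.
  subst n c; exists [::]; split=> //; first by rewrite proof_size_nil.
  by apply: provN_weak (Hbase p ps) => // a; right.
subst n c; set W := B _.
have [||||E1 [q [E1b E1s HE1 qs qb]]] := @coloring_step (r + n0) (r + c0) b p _ _ _ _ ps pb.
- by lia.
- by lia.
- exact: fit.
- by apply: fit; lia.
have [|E2 [E2b E2s HE2]] := IH _ _ (b + size E1) q erefl erefl _ qs qb.
  by move=> n' nn; apply: fit; lia.
exists (E1 ++ E2); split; first exact: extension_list_cat.
  by rewrite proof_size_cat mulSn leq_add.
have H1 : provN F W (unionc (inc (E1 ++ E2)) (coloring_axioms k p)) (coloring_axioms k q).
  apply: provN_weak HE1 => // a [Ha|Ha]; [left|by right].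
  by rewrite /inc mem_cat [a \in E1]Ha.
have H2 := provN_cut H1 (provN_weak (leqnn _) _ (fun _ x => x) HE2).
rewrite mulSn -addnA; apply: (provN_weak _ _ _ (H2 _)) => // [a|a [Ha|Ha]].
- by right.
- by right; left; rewrite /inc mem_cat [a \in E2]Ha orbT.
- by left.
Qed.

End Loop.

(** * From the refutation to the Kneser formula *)

Section Final.
Variables (F : seq rule) (C M : nat).
Context {FCM : setting F C M}.

Local Notation B := (bound C M).
Local Notation small := (small C M).
Local Notation nd := (nd F C M).
Local Notation nds := (nds F C M).

Lemma bound_exp d j : j <= d.+1 -> M ^ j <= B d.
Proof.
have M1 : 1 < M := @setting_gt1 F C M FCM.
move=> jd; apply: (@leq_trans (M ^ d.+1)); first by rewrite leq_exp2l ?M1.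
elim: d {j jd} => // d IH; apply: leq_trans (bound_mul d); rewrite expnS.
apply: leq_mul => //; exact: (bound_le (leq0n d)).
Qed.

(** The premise of the formula contains the totality axioms, and the negated conclusion yields every
    axiom on disjoint pairs; the refutation then closes the argument by contradiction. *)
Lemma nd_kneser d e n k E : ncolors n k <= B d -> size (vertices n k) <= B d ->
  d + 10 <= e -> 
  nd e (unionc (inc E) (coloring_axioms k (@pvar n k))) Bot ->
  nd (e + 20) (inc E) (kneser n k).
Proof.
move=> cB vB de HB.
have sp e' U i : small e' (@pvar n k U i) by apply: small_var.
have stot e' U : d.+1 <= e' -> small e' (total_at (@pvar n k) U).
  move=> de'; apply: (small_le de'); by apply: small_total => [|i]; [rewrite card_ord | apply: sp].
rewrite /kneser; set A := conj _; set D := disj _.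
have sA e' : d.+3 <= e' -> small e' A.
  move=> de'; apply: (small_le de'); apply: small_conj => [|a /mapP[U _ ->]].
    by rewrite size_map; apply: leq_trans vB _; apply: bound_le; lia.
  by apply: stot; lia.
have sDD e' U V : d.+3 <= e' ->
    small e' (disj [seq And (pvar U i) (pvar V i) | i <- enum 'I_(ncolors n k)]).
  move=> de'; apply: (small_le de'); apply: small_disj => [|a /mapP[i _ ->]].
    by rewrite size_map size_enum_ord; apply: leq_trans cB _; apply: bound_le; lia.
  exact: small_and.
have sD e' : d.+4 <= e' -> small e' D.
  move=> de'; apply: (small_le de'); apply: small_disj; last first.
    by move=> a /allpairsPdep[U [V [_ _ ->]]]; apply: sDD.
  rewrite size_allpairs_dep sumnE big_map.
  apply: (@leq_trans (\sum_(U <- vertices n k) B d)).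
    apply: leq_sum => U _; rewrite size_filter; apply: leq_trans (count_size _ _) vB.
  rewrite big_const_seq count_predT iter_addn_0.
  apply: leq_trans (leq_mul (leqnn _) vB) _; apply: leq_trans (bound_mul _) _.
  by apply: bound_le; lia.
apply: (@nd_le _ _ _ _ (e + 19).+1); first by lia.
apply: nd_ded; last by apply: sA; lia.
apply: (@nd_le _ _ _ _ (e + 15).+2); first by lia.
apply: nd_raa; last by apply: (@small_le _ _ _ _ d.+4.+1); [lia | apply: small_neg; apply: sD].
set G := addc _ _.
apply: (@nd_le _ _ _ _ (e + 13).+1); first by lia.
apply: (nd_cut (L := coloring_axioms k (@pvar n k))); last first.
  apply: nd_weak (nd_le _ HB) => [a [Ha|Ha]|]; last by lia.
    by right; right; right.
  by left.
apply: (@nds_le _ _ _ _ (e + 10).+3); first by lia.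
apply: nds_coloring_axioms => [||U Uk|U V i Uk Vk UV].
- by apply: leq_trans vB _; apply: bound_le; lia.
- by apply: leq_trans cB _; apply: bound_le; lia.
- apply: (nd_conje (s := [seq total_at (@pvar n k) U | U <- vertices n k])).
    by apply: nd_add; apply: nd_assum; apply: sA; lia.
  by apply: map_f; rewrite mem_vertices Uk.
have sUV e' : d.+1 <= e' -> small e' (And (pvar U i) (pvar V i)).
  by move=> de'; apply: (small_le de'); apply: small_and.
apply: (@nd_le _ _ _ _ (e + 8).+2); first by lia.
apply: nd_neg; last by apply: sUV; lia.
apply: (@nd_le _ _ _ _ (e + 6).+1); first by lia.
apply: (nd_nege (a := D)); last first.
  apply: nd_add; apply: nd_assum; apply: (@small_le _ _ _ _ d.+4.+1); first by lia.
  by apply: small_neg; apply: sD.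
apply: (@nd_le _ _ _ _ (e + 4).+2); first by lia.
apply: (@nd_disj _ _ _ _ _ _ _ (disj [seq And (pvar U i) (pvar V i) | i <- enum 'I_(ncolors n k)])).
- apply/allpairsPdep; exists U, V; split=> //; first by rewrite mem_vertices Uk.
  by rewrite mem_filter UV mem_vertices Vk eqxx.
- apply: (@nd_disj _ _ _ _ _ _ _ (And (pvar U i) (pvar V i))).
  + by apply: map_f; rewrite mem_enum.
  + by apply: nd_assum; apply: sUV; lia.
  + by apply: sDD; lia.
- by apply: sD; lia.
Qed.

End Final.

(* An extension axiom must not be repeated, as its variable is no longer fresh. *)
Lemma valid_strip F E pf : valid F (inc E) pf -> exists pf', [/\
  forall prev b next, pf' = prev ++ b :: next -> inferred F (E ++ prev) b,
  {subset pf <= E ++ pf'} & proof_size pf' <= proof_size pf].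
Proof.
elim=> [|q b _ [pf' [H1 H2 H3]] Hb]; first by exists [::]; split=> // -[].
case: Hb => [bE|inf].
  exists pf'; split=> // [x|]; last by rewrite proof_size_rcons; lia.
  by rewrite mem_rcons inE => /predU1P[->|/H2]; rewrite // mem_cat [b \in E]bE.
exists (rcons pf' b); split=> [prev c next|x|].
- case/lastP: next => [|next c'].
    rewrite cats1 => /eqP; rewrite eqseq_rcons => /andP[/eqP<- /eqP<-].
    exact: inferred_sub inf.
  rewrite -rcons_cons -rcons_cat => /eqP; rewrite eqseq_rcons => /andP[/eqP e _].
  exact: H1 e.
- by rewrite mem_rcons inE -rcons_cat mem_rcons inE => /predU1P[->|/H2 ->];
    rewrite ?eqxx ?orbT.
- by rewrite !proof_size_rcons leq_add2r.
Qed.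

Lemma extension_list_nth b E prev e next : extension_list b E ->
  E = prev ++ e :: next ->
  (exists2 c, e = Iff (Var (b + size prev)) c & below (b + size prev) c) /\
  all (below (b + size prev)) prev.
Proof.
elim: E b prev => [|e0 E IH] b [|a prev] //= [[c e0E cb] HE] [ea eE].
  by split=> //; exists c; rewrite -?ea addn0.
have [[c' eE' cb'] Hp] := IH _ prev HE eE; rewrite addSnnS in eE' cb' Hp.
split; first by exists c'.
rewrite Hp andbT -ea e0E /Iff below_and !below_imp.
have cb2 : below (b + (size prev).+1) c by apply: below_le cb; apply: leq_addr.
by rewrite cb2 /below /= !andbT addnS ltnS leq_addr.
Qed.

(** All extension axioms are placed first, so their variables need to be compared only with earlier
    extension axioms and with [a], which lies below [b]. *)
Lemma ext_frege_proof_intro F a b E N : below b a -> extension_list b E -> a \notin E ->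
  provN F N (inc E) (eq a) ->
  exists2 pf, ext_frege_proof F a pf & proof_size pf <= proof_size E + N.
Proof.
move=> ab Eb aE [pf [v /(_ a erefl) apf szpf]].
have [pf' [H1 H2 H3]] := valid_strip v.
have {}apf : a \in pf' by move: (H2 _ apf); rewrite mem_cat (negbTE aE).
(* The proof is cut off after an occurrence of [a], which must be its last line. *)
case/splitPr: pf' / apf H1 {H2} H3 => l1 l2 H1 H3.
exists (E ++ rcons l1 a); last first.
  rewrite proof_size_cat leq_add2l; apply: leq_trans szpf; apply: leq_trans H3.
  by rewrite -cat_rcons proof_size_cat leq_addr.
split; first by exists (E ++ l1); rewrite rcons_cat.
move=> prev e next epf; case: (ltnP (size prev) (size E)) => sz.
  right; have [next' eE] : exists next', E = prev ++ e :: next'.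
    have : take (size E) (E ++ rcons l1 a) = take (size E) (prev ++ e :: next).
      by rewrite epf.
    rewrite take_size_cat // take_cat ltnNge (ltnW sz) /=.
    case: (size E - size prev) (subn_gt0 (size prev) (size E)) => [|m _] /=.
      by rewrite sz.
    by exists (take m next).
  have [[c ec cb] Hp] := extension_list_nth Eb eE.
  exists (b + size prev), c; split=> //.
  - by apply/negP => /(allP cb); rewrite ltnn.
  - apply/negP => /flattenP[_ /mapP[x xp ->]] xv.
    by have := allP (allP Hp x xp) _ xv; rewrite ltnn.
  - by apply/negP => /(allP ab); lia.
left; have [p2 ep] : exists p2, prev = E ++ p2.
  exists (drop (size E) prev); rewrite -{1}(cat_take_drop (size E) prev); congr (_ ++ _).
  by have := congr1 (take (size E)) epf; rewrite take_size_cat // takel_cat // => ->.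
rewrite ep; apply: (H1 _ _ (next ++ l2)).
have e1 : rcons l1 a = p2 ++ e :: next.
  by apply/eqP; move: epf; rewrite ep -catA => /eqP; rewrite eqseq_cat // eqxx.
by rewrite -cat_rcons e1 -catA.
Qed.

(** The degree triples with each level; this is where the level must not depend on [n]. *)
Lemma bound_polynomial C d : exists A t, forall n, 0 < n -> bound C (n + 2) d <= A * n ^ t.
Proof.
elim: d => [|d [A [t H]]]; first by exists 3, 1 => n n0; rewrite /bound expn1; lia.
exists ((C + 5) * A ^ 3), (t * 3) => n n0; rewrite boundS.
have -> : bound C (n + 2) d * (bound C (n + 2) d * bound C (n + 2) d) = bound C (n + 2) d ^ 3.
  by rewrite !expnS expn0 muln1.
by rewrite expnM -mulnA -expnMn leq_mul2l leq_exp2r // H // orbT.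
Qed.

(** Below the threshold only finitely many formulas occur; completeness gives each a plain Frege
    proof, and the sum of the sizes bounds them all. *)
Lemma small_kneser_proofs F k N : frege_system F -> 0 < k ->
  exists K, forall n, n < N -> 2 * k <= n ->
    exists2 pf, ext_frege_proof F (kneser n k) pf & proof_size pf <= K.
Proof.
move=> hF k0; elim: N => [|N [K IH]]; first by exists 0.
have [kN|kN] := leqP (2 * k) N; last first.
  by exists K => n; rewrite ltnS leq_eqVlt => /predU1P[->|/IH//]; rewrite leqNgt kN.
have [pf [pfa pfH]] := hF.2 _ _ (kneser_valid k0 kN).
exists (K + proof_size pf) => n; rewrite ltnS leq_eqVlt => /predU1P[->|nN] kn.
  exists pf; last exact: leq_addl.
  by split=> // prev b next /pfH[|]; [rewrite in_nil | left].
by have [pf' H1 H2] := IH n nN kn; exists pf' => //; apply: leq_trans H2 (leq_addr _ _).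
Qed.

Theorem theorem4 (F : seq rule) (hF : frege_system F) (k : nat) (hk : 1 <= k) :
  exists f : {poly nat}, forall n : nat, 2 * k <= n ->
    exists2 pf : seq formula,
      ext_frege_proof F (kneser n k) pf & proof_size pf <= f.[n]%R.
Proof.
pose n0 := 2 * k ^ 6; pose c0 := n0 - 2 * k + 1.
have kn0 : 2 * k <= n0.
  by rewrite leq_mul2l /= -{1}(expn1 k) leq_pexp2l.
have [Cb Hb] := @coloring_refutation_const F n0 k c0 hF hk kn0 erefl.
have [C1 HC1] := cost_constant_exists hF.
pose C := C1 + Cb; have HC : cost_constant F C by apply: HC1; apply: leq_addr.
(* At level [d] there is room for powers of [n + 2] up to exponent [d + 1], enough for the
   [(n + 2) ^ k] vertices and for the pigeons, bounded by exponent [2 * k + 1]. [W] is the level of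
   one round. *)
pose d := 4 * k + 4; pose W := d + 10 * (k * k) + 120.
have [A [t HA]] := bound_polynomial C (W + 50).
have [K HK] := small_kneser_proofs n0 hF hk.
exists (K%:P + A *: 'X^t)%R => n kn.
have -> : ((K%:P + A *: 'X^t : {poly nat}).[n])%R = K + A * n ^ t.
  by rewrite hornerD hornerC hornerZ hornerXn natrXE.
have [nn0|n0n] := ltnP n n0.
  by have [pf H1 H2] := HK n nn0 kn; exists pf => //; apply: leq_trans H2 (leq_addr _ _).
have FCM : setting F C (n + 2) by split=> //; lia.
have n_gt0 : 0 < n by lia.
(* Extension variables start above all codes of original variables; the size of the codes is
   irrelevant, as a variable counts as one symbol. *)
pose b := (\max_(z : {set 'I_n} * 'I_(ncolors n k)) pickle z).+1.
have pb U i : below b (@pvar n k U i).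
  rewrite /below /= andbT ltnS; exact: (leq_bigmax (U, i)).
have fit n' : n' <= n -> fits C (n + 2) k d n'.
  move=> nn; have M1 : n + 2 <= bound C (n + 2) d.
    by rewrite -[X in X <= _]expn1; apply: (@bound_exp F).
  split; first by apply: leq_trans M1; lia.
    apply: leq_trans (size_vertices_le k (leq_trans nn (leq_addr 2 n))) _.
    by apply: (@bound_exp F); rewrite /d; lia.
  apply: (@leq_trans ((n + 2) ^ (1 + (k + k)))).
    rewrite expnD expn1 expnD; have kM : k <= (n + 2) ^ k by rewrite ltnW // ltn_expl //; lia.
    have := leq_mul kM kM; set kk := k * k; set X := _ * _ => kX.
    have : n' * kk <= n * X by apply: leq_mul.
    have : 0 < kk by rewrite muln_gt0 hk.
    by rewrite mulnDl; lia.
  by apply: (@bound_exp F); rewrite /d; lia.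
have [|||||E [Eb Es HE]] := @coloring_loop F C (n + 2) FCM k n0 c0 d hk (leqnn _) _
  (bound C (n + 2) d.+1) (n - n0) n (ncolors n k) b (@pvar n k) _ _ _ fit _ pb.
- by rewrite /c0; lia.
- move=> p ps; apply: provN_leq (Hb p _ (ltnW (@bound_gt1 F C (n + 2) FCM d)) ps).
  apply: (@leq_trans (C * (bound C (n + 2) d * bound C (n + 2) d))).
    by apply: leq_mul; [rewrite /C leq_addl | rewrite leq_pmulr // ltnW // (@bound_gt1 F)].
  by apply: (@bound_quad F); apply: leq_addr.
- by rewrite subnK.
- by rewrite /ncolors /c0; lia.
- by move=> U i; apply: (@small_var F).
have sW : n <= bound C (n + 2) W.
  by have [M1 _ _] := fit n (leqnn n); apply: leq_trans M1 _; apply: (@bound_le F); rewrite /W; lia.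
have mulW : (n - n0) * bound C (n + 2) W <= bound C (n + 2) W.+1.
  apply: leq_trans (@bound_mul F _ _ FCM W); rewrite leq_mul2r; apply/orP; right.
  exact: leq_trans (leq_subr _ _) sW.
have HE' : nd F C (n + 2) W.+2 (unionc (inc E) (coloring_axioms k (@pvar n k))) Bot.
  apply: provN_leq HE; apply: leq_trans (@bound_mul F _ _ FCM W.+1).
  have : bound C (n + 2) d.+1 <= bound C (n + 2) W.+1 by apply: (@bound_le F); rewrite /W; lia.
  have := @bound_gt1 F _ _ FCM W.+1.
  move: mulW; rewrite -/W; move: (bound C (n + 2) W.+1) (_ * _) (bound C (n + 2) d.+1) => x y z.
  nia.
have [M1 M2 M3] := fit n (leqnn n).
have cB : ncolors n k <= bound C (n + 2) d by rewrite /ncolors; lia.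
have dW : d + 10 <= W.+2 by rewrite /W; lia.
have H := @nd_kneser F C (n + 2) FCM d _ _ _ _ cB M2 dW HE'.
have kb : below b (kneser n k).
  rewrite below_imp below_conj below_disj; apply/andP; split; apply/allP => a.
    by case/mapP => U _ ->; rewrite below_disj; apply/allP => _ /mapP[i _ ->]; apply: pb.
  case/allpairsPdep => U [V [_ _ ->]]; rewrite below_disj; apply/allP => _ /mapP[i _ ->].
  by rewrite below_and !pb.
(* Extension axioms are conjunctions, whereas the Kneser formula is an implication. *)
have aE : kneser n k \notin E.
  apply/negP => /[dup] aE; case/splitPr: E / aE Eb {Es HE HE' H} => p1 p2 Eb _.
  by have [[c ec _] _] := extension_list_nth Eb erefl.
have [pf Hpf szpf] := ext_frege_proof_intro kb Eb aE H.
exists pf => //; apply: leq_trans szpf _; apply: leq_trans (leq_trans (HA n n_gt0) (leq_addl K _)).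
apply: leq_trans (bound_le (F := F) (_ : (W + 23).+1 <= W + 50)); last by lia.
apply: leq_trans (@bound_mul F _ _ FCM (W + 23)).
have e1 : proof_size E <= bound C (n + 2) (W + 23).
  apply: leq_trans Es _; apply: leq_trans mulW _; apply: (@bound_le F); lia.
have e2 : bound C (n + 2) (W.+2 + 20) <= bound C (n + 2) (W + 23).
  by apply: (@bound_le F); lia.
have B1 := @bound_gt1 F _ _ FCM (W + 23).
by apply: leq_trans (leq_add e1 e2) _; nia.
Qed.
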